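(* For any $a\in[0,1]$, the set $$H_a([0,1])=\{\phi\in C^0([0,1]):\ \overline{\mathrm{mdim}}_{\mathrm H}([0,1],|\cdot|,\phi)=\underline{\mathrm{mdim}}_{\mathrm H}([0,1],|\cdot|,\phi)=a\}$$ is dense in $C^0([0,1])$.
   Context: $C^0([0,1])$ is the set of continuous maps $\phi:[0,1]\to[0,1]$, with the metric $\hat d(\phi,\varphi)=\max_{x\in[0,1]}|\phi(x)-\varphi(x)|$. $|\cdot|$ denotes the metric on $[0,1]$ induced by the absolute value. Mean Hausdorff dimension. Let $(N,d)$ be a compact metric space and $\phi:N\to N$ continuous. For $n\ge1$ set $d_n(x,y)=\max\{d(x,y),d(\phi(x),\phi(y)),\dots,d(\phi^{n-1}(x),\phi^{n-1}(y))\}$, and let $\mathrm{diam}_{d_n}(A)$ be the diameter of $A\subseteq N$ with respect to $d_n$. For $s\ge0$, $\varepsilon>0$ let $$\mathrm H^s_\varepsilon(N,d_n,\phi)=\inf\Big\{\sum_{i=1}^\infty(\mathrm{diam}_{d_n}E_i)^s:\ N=\bigcup_{i=1}^\infty E_i,\ \mathrm{diam}_{d_n}E_i\le\varepsilon\ \text{for all } i\Big\},$$ with the conventions $0^0=1$ and $\mathrm{diam}_{d_n}(\emptyset)^s=0$. Let $\dim_{\mathrm H}(N,d_n,\phi,\varepsilon)=\sup\{s\ge0:\mathrm H^s_\varepsilon(N,d_n,\phi)\ge1\}$. The upper and lower mean Hausdorff dimensions are $$\overline{\mathrm{mdim}}_{\mathrm H}(N,d,\phi)=\lim_{\varepsilon\to0}\limsup_{n\to\infty}\tfrac1n\dim_{\mathrm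 H}(N,d_n,\phi,\varepsilon),\qquad \underline{\mathrm{mdim}}_{\mathrm H}(N,d,\phi)=\lim_{\varepsilon\to0}\liminf_{n\to\infty}\tfrac1n\dim_{\mathrm H}(N,d_n,\phi,\varepsilon).$$ *)

(* Defs.v *)
From HB Require Import structures.
From mathcomp Require Import all_boot all_order all_algebra.
From mathcomp Require Import all_classical all_reals all_analysis.
Set Implicit Arguments.
Unset Strict Implicit.
Unset Printing Implicit Defensive.
Import Order.TTheory GRing.Theory Num.Theory.
Import numFieldNormedType.Exports.
Local Open Scope classical_set_scope.
Local Open Scope ring_scope.

Definition unit_interval (R : realType) : Type := set_type (`[0, 1]%classic : set R).

HB.instance Definition _ (R : realType) :=
  PseudoMetric.copy (unit_interval R) (set_type (`[0, 1]%classic : set R)).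

Section unit_interval_metric.
Context {R : realType}.
Implicit Types x y : unit_interval R.

Definition ui_val (x : unit_interval R) : R := set_val x.

Lemma ui_val_itv x : 0 <= ui_val x <= 1.
Proof. by have := set_valP x; rewrite /= in_itv. Qed.

Definition ui_dist x y : R := `|ui_val x - ui_val y|.

Let dist_ge0 x y : 0 <= ui_dist x y.
Proof. exact: normr_ge0. Qed.

Let dist_positivity x y : ui_dist x y = 0 -> x = y.
Proof. by move=> /normr0_eq0 /eqP; rewrite subr_eq0 => /eqP /val_inj. Qed.

Let ball_dist x (e : R) : ball x e = [set y | ui_dist x y < e].
Proof. by []. Qed.

HB.instance Definition _ := @PseudoMetric_isMetric.Build R (unit_interval R)
  ui_dist dist_ge0 dist_positivity ball_dist.

End unit_interval_metric.

Section mean_hausdorff_dimension.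
Context {R : realType} {N : metricType R}.
Variable phi : N -> N.
Local Open Scope ereal_scope.

Definition dyn_dist (n : nat) (x y : N) : R :=
  \big[Num.max/0%R]_(i < n) mdist (iter i phi x) (iter i phi y).

Definition dyn_diam (n : nat) (A : set N) : \bar R :=
  maxe 0 (ereal_sup [set (dyn_dist n p.1 p.2)%:E | p in A `*` A]).

(* [poweR] already satisfies 0 `^ 0 = 1; only the empty set is special *)
Definition dyn_diam_pow (n : nat) (s : R) (A : set N) : \bar R :=
  if A == set0 then 0 else poweR (dyn_diam n A) s.

Definition hausdorff_content (n : nat) (eps s : R) : \bar R :=
  ereal_inf [set \sum_(0 <= i <oo) dyn_diam_pow n s (E i) | E in
    [set E : nat -> set N | \bigcup_i E i = [set: N] /\
                            forall i, dyn_diam n (E i) <= eps%:E]].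

Definition hausdorff_dim (n : nat) (eps : R) : \bar R :=
  ereal_sup [set s%:E | s in
    [set s : R | (0 <= s)%R /\ 1 <= hausdorff_content n eps s]].

(* [hausdorff_dim n] is nonincreasing in [eps], so both limits exist; the
   term of index n = 0 has no influence on the limits in n *)
Definition upper_mdimH : \bar R :=
  lim ((fun eps : R =>
    limn_esup (fun n => (n%:R^-1)%:E * hausdorff_dim n eps)) @ 0^'+).

Definition lower_mdimH : \bar R :=
  lim ((fun eps : R =>
    limn_einf (fun n => (n%:R^-1)%:E * hausdorff_dim n eps)) @ 0^'+).

End mean_hausdorff_dimension.

(* an alias of [continuousType], so that the uniform metric below does not
   compete with the topologies the library offers on [continuousType] *)
Definition C0 (R : realType) : Type :=
  continuousType (unit_interval R) (unit_interval R).

HB.instance Definition _ (R : realType) := Choice.copy (C0 R)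
  (continuousType (unit_interval R) (unit_interval R)).

Section uniform_metric.
Context {R : realType}.
Implicit Types f g h : C0 R.

(* a maximum, by compactness *)
Definition C0_dist f g : R :=
  sup [set mdist (f x) (g x) | x in [set: unit_interval R]].

Lemma C0_dist_ubound f g x : mdist (f x) (g x) <= C0_dist f g.
Proof.
apply: ub_le_sup; last by exists x.
exists 1 => _ [y _ <-].
have /andP[f0 f1] := ui_val_itv (f y); have /andP[g0 g1] := ui_val_itv (g y).
rewrite /mdist/= /ui_dist ler_norml lerBrDr lerBlDr.
by rewrite (le_trans _ f0) ?(le_trans f1) ?lerDl// addrC subr_le0.
Qed.

Lemma ui_nonempty : [set: unit_interval R] !=set0.
Proof.
have h0 : (0 : R) \in (`[0, 1]%classic : set R) by rewrite inE /= in_itv /= lexx ler01.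
by exists (exist _ 0 h0).
Qed.

Lemma C0_dist_le f g (c : R) :
  (forall x, mdist (f x) (g x) <= c) -> C0_dist f g <= c.
Proof.
move=> fgc; apply: ge_sup => [|_ [x _ <-]]; last exact: fgc.
by have [x _] := ui_nonempty; exists (mdist (f x) (g x)), x.
Qed.

Let dist_sym f g : C0_dist f g = C0_dist g f.
Proof.
by rewrite /C0_dist; congr (sup (_ @` _)); apply/funext => x; exact: metric_sym.
Qed.

Let distxx f : C0_dist f f = 0.
Proof.
apply/eqP; rewrite eq_le C0_dist_le => [|x]; last by rewrite mdistxx.
have [x _] := ui_nonempty.
by rewrite (le_trans _ (C0_dist_ubound f f x))// mdist_ge0.
Qed.

Let dist_positivity f g : C0_dist f g = 0 -> f = g.
Proof.
move=> fg0; apply/continuousEP => x; apply: mdist_positivity; apply/eqP.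
by rewrite eq_le mdist_ge0 andbT -fg0 C0_dist_ubound.
Qed.

Let dist_triangle g f h : C0_dist f h <= C0_dist f g + C0_dist g h.
Proof.
apply: C0_dist_le => x; apply: (le_trans (metric_triangle _ (g x) _)).
by apply: lerD; exact: C0_dist_ubound.
Qed.

HB.instance Definition _ := @isMetric.Build R (C0 R)
  C0_dist distxx dist_positivity dist_sym dist_triangle.

End uniform_metric.

Definition mdimH_level (R : realType) (a : R) : set (C0 R) :=
  [set phi | upper_mdimH phi = a%:E /\ lower_mdimH phi = a%:E].

(* Main.v *)
Require Import Defs.
From HB Require Import structures.
From mathcomp Require Import all_boot all_order all_algebra.
From mathcomp Require Import all_classical all_reals all_analysis.
From mathcomp Require Import lra ring zify.
Set Implicit Arguments.
Unset Strict Implicit.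
Unset Printing Implicit Defensive.
Import Order.TTheory GRing.Theory Num.Theory.
Import numFieldNormedType.Exports.
Local Open Scope classical_set_scope.
Local Open Scope ring_scope.

(** A continuous map that is locally Lipschitz off a countable set gives the
    metrics [dyn_dist n] Hausdorff dimension at most 1 for every [n], by countable
    stability, and hence mean Hausdorff dimension 0. A positive value therefore
    needs a Cantor set on which the map is far from Lipschitz, and the control of
    everything else needs countable stability again.

    Let [C] be a Cantor set with [2 ^ k] pieces of length about [2 `^ (- k / a)] at
    level [k], whose points are coded by binary sequences [omega], and consider
    the map of [C] that sends [omega] to [omega \o m] with [m i = (i + 2) ^ 2].
    The first [k] digits of the first [n] points of an orbit are the digits of
    [omega] at the places [iter j m i] with [j < n] and [i < k]; since [m] is
    injective with sparse range, about [n * k] of these places are different. A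
    set of [dyn_dist n]-diameter about [2 `^ (- k / a)] thus fixes about [n * k]
    digits, that is, has mass about its diameter to the power [n * a] for fair
    coin tosses, uniformly in [n]. This makes the Hausdorff content of exponent
    [n * s] at least 1 for all [s < a] and small scales ([hausdorff_dim_ge],
    resting on [cylinder_cover_ge1] and [rate_eventually]).

    The map extends continuously to the interval by extending each digit linearly
    over the gaps of [C] ([digit]), so that it is affine on every gap. The whole
    space is then the union of a set of box dimension [a] and of countably many
    pieces on which the map is constant or expands distances. Going one step back
    in time costs [a] in the exponent on the first set and nothing on an expanding
    piece, and an orbit through a piece of constancy stops branching; by induction
    the Hausdorff measure of exponent [s] vanishes for [dyn_dist n.+1] as soon as
    [s > n * a + 1] ([hcost_dyn_dist_null]). Both bounds give mean Hausdorff
    dimension [a] ([mdimH_eq]).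

    Density follows since nothing was asked of the map elsewhere than being
    piecewise affine: a given function is interpolated linearly on a fine grid,
    its graph crosses the diagonal in some cell, and in that cell the linear piece
    is replaced by a scaled copy of the map above ([splice_near]). *)

(** * Countably subadditive covering costs *)

Section hcost.
Context {R : realType} {T : Type}.
Variable d : T -> T -> R.
Local Open Scope ereal_scope.

(** A cover comes with numbers [r i] bounding the diameters, instead of the
    diameters themselves, so that a cover can be pulled back or rescaled without
    computing a supremum. Positivity on nonempty sets keeps negative powers of
    the [r i] meaningful; empty sets may be given size 0, hence be free. *)
Definition scale_cover (A : set T) (E : nat -> set T) (r : nat -> R) :=
  [/\ forall i, (0 <= r i)%R, A `<=` \bigcup_i E i &
      forall i x y, E i x -> E i y -> (0 < r i)%R /\ (d x y <= r i)%R].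

(** The Hausdorff outer measure without bound on the sizes. It is used through
    the condition [hcost d s A = 0], which for [0 < s] amounts to the vanishing
    of the usual Hausdorff measure: small total cost forces small sizes. *)
Definition hcost (s : R) (A : set T) : \bar R :=
  ereal_inf [set x | exists E r, scale_cover A E r /\
                       x = \sum_(i <oo) (r i `^ s)%:E].

Lemma hcost_ge0 s A : 0 <= hcost s A.
Proof.
apply: le_ereal_inf_tmp => _ [E [r [_ ->]]].
by apply: nneseries_ge0 => n _ _; rewrite lee_fin powR_ge0.
Qed.

Lemma le_hcost s A B : A `<=` B -> hcost s A <= hcost s B.
Proof.
move=> AB; apply: ereal_inf_le_tmp => _ [E [r [[r0 BE dE] ->]]].
by exists E, r; split => //; split => //; exact: subset_trans BE.
Qed.

(** Countable subadditivity is what lets a countable partition of the space into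
    simple pieces be treated piece by piece; a counting of balls at a fixed
    scale would not survive the infinitely many pieces. *)
Lemma hcost_bigcup s (A : nat -> set T) :
  hcost s (\bigcup_i A i) <= \sum_(i <oo) hcost s (A i).
Proof.
have [[i ioo]|] := pselect (exists i, hcost s (A i) = +oo).
  rewrite (eseries_pinfty _ _ ioo) ?leey// => n _.
  by rewrite -ltNye (lt_le_trans _ (hcost_ge0 _ _)).
rewrite -forallNE => Aoo.
suff add2e (e : R) : (0 < e)%R ->
    hcost s (\bigcup_n A n) <= \sum_(i <oo) hcost s (A i) + e%:E.
  by apply/lee_addgt0Pr.
move=> e0; rewrite (le_trans _ (epsilon_trick _ _ (ltW e0)))//; last first.
  by move=> n; exact: hcost_ge0.
have /choice[G PG] n : exists Er : (nat -> set T) * (nat -> R),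
    scale_cover (A n) Er.1 Er.2 /\
    \sum_(k <oo) (Er.2 k `^ s)%:E <= hcost s (A n) + (e / (2 ^ n.+1)%:R)%:E.
  have en : (0 < e / (2 ^ n.+1)%:R)%R by rewrite divr_gt0// ltr0n expn_gt0.
  have fA : hcost s (A n) \is a fin_num.
    by rewrite ge0_fin_numE ?hcost_ge0// lt_neqAle leey andbT; apply/eqP/Aoo.
  have [x [E [r [cE ->]]] /ltW lx] := lb_ereal_inf_adherent en fA.
  by exists (E, r).
pose c (p : nat * nat) := ((G p.1).2 p.2 `^ s)%:E.
have c0 p : 0 <= c p by rewrite lee_fin powR_ge0.
apply: (@le_trans _ _ (\esum_(i in setT) c i)).
  have /card_esym/ppcard_eqP[f] := card_nat2.
  apply: ereal_inf_lbound; exists (fun i => (G (f i).1).1 (f i).2).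
  exists (fun i => (G (f i).1).2 (f i).2); split; first split.
  - by move=> i; have [[+ _ _] _] := PG (f i).1; apply.
  - move=> t [n _ Ant]; have [[_ /(_ _ Ant)[k _ Gt] _] _] := PG n.
    by exists (f^-1%FUN (n, k)) => //=; rewrite invK ?inE.
  - by move=> i; have [[_ _ +] _] := PG (f i).1; apply.
  rewrite nneseries_esumT; last by move=> n; rewrite lee_fin powR_ge0.
  by rewrite (@reindex_esum _ _ _ setT setT f).
rewrite (_ : esum _ _ = \sum_(i <oo) \sum_(j <oo) c (i, j)); last first.
  rewrite nneseries_esumT; last by move=> n; apply: nneseries_ge0.
  rewrite [RHS](_ : _ = \esum_(i in setT) \esum_(j in setT) c (i, j)); last first.
    by apply: eq_esum => i _; rewrite nneseries_esumT.
  rewrite (@esum_esum _ _ _ setT (fun=> setT) (fun i j => c (i, j)))//.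
  rewrite (_ : setT `*`` _ = setT); last by apply/seteqP; split.
  by apply: eq_esum => -[].
apply: lee_nneseries => n _; first by move=> _; apply: nneseries_ge0.
by have [] := PG n.
Qed.

Lemma hcost_finite s A M (P : nat -> set T) (r : R) : s != 0%R -> (0 < r)%R ->
  A `<=` \bigcup_(l < M) P l ->
  (forall l x y, P l x -> P l y -> (d x y <= r)%R) ->
  hcost s A <= (M%:R * r `^ s)%:E.
Proof.
move=> s0 r0 AP dP; apply: ereal_inf_lbound.
(* the cover is padded with empty sets of size 0, free because s != 0 *)
exists (fun i => if (i < M)%N then P i else set0).
exists (fun i => if (i < M)%N then r else 0%R); split; first split.
- by move=> i; case: ifP => // _; exact: ltW.
- by move=> x /AP[l /= lM Plx]; exists l => //; rewrite lM.
- by move=> i x y; case: ifP => // _ Px Py; split=> //; exact: dP Px Py.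
rewrite (nneseries_split 0 M); last by move=> k _; rewrite lee_fin powR_ge0.
rewrite eseries0; last first.
  by move=> i /= Mi _; rewrite add0n in Mi; rewrite ltnNge Mi/= powR0.
rewrite adde0 add0n big_nat (eq_bigr (fun=> (r `^ s)%:E)); last first.
  by move=> i /andP[_ ->].
by rewrite -big_nat sumEFin sumr_const_nat subn0 mulr_natl.
Qed.

Lemma hcost_null_bigcup s (A : nat -> set T) :
  (forall i, hcost s (A i) = 0) -> hcost s (\bigcup_i A i) = 0.
Proof.
move=> A0; apply/eqP; rewrite eq_le hcost_ge0 andbT.
by rewrite (le_trans (hcost_bigcup _ _))// eseries0// => i _ _.
Qed.

Lemma hcost_null_setU s A B :
  hcost s A = 0 -> hcost s B = 0 -> hcost s (A `|` B) = 0.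
Proof.
move=> A0 B0; rewrite -bigcup2E; apply: hcost_null_bigcup => -[|[|i]] //=.
apply/eqP; rewrite eq_le hcost_ge0 andbT.
by rewrite -A0; apply: le_hcost => ? [].
Qed.

End hcost.

(** Upper box dimension at most [t], with the exponent attained. *)
Definition box_dim_le (R : realType) (N : metricType R) (C : set N) (t : R) :=
  exists2 K : R, 0 <= K & forall r, 0 < r <= 1 ->
    exists M (P : nat -> set N), [/\ M%:R <= K * r `^ (- t),
      C `<=` \bigcup_(l < M) P l &
      forall l x y, P l x -> P l y -> mdist x y <= r].

(** * Upper bound by induction on the time *)

Section dynamical_null_sets.
Context {R : realType} {N : metricType R}.
Variable phi : N -> N.

Lemma dyn_distS n x y :
  dyn_dist phi n.+1 x y = Num.max (mdist x y) (dyn_dist phi n (phi x) (phi y)).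
Proof.
rewrite /dyn_dist big_ord_recl/=; congr Num.max.
by apply: eq_bigr => i _; rewrite -!iterS !iterSr.
Qed.

Lemma dyn_dist_ge0 n x y : 0 <= dyn_dist phi n x y.
Proof.
elim: n x y => [|n IH] x y; first by rewrite /dyn_dist big_ord0.
by rewrite dyn_distS le_max mdist_ge0.
Qed.

Lemma hcost_box (C A : set N) t (s : R) (d : N -> N -> R) : box_dim_le C t ->
  A `<=` C -> (forall x y, A x -> A y -> d x y <= mdist x y) ->
  0 < s -> t < s -> hcost d s A = 0.
Proof.
move=> [K K0 boxC] AC dA s0 ts; apply/eqP; rewrite eq_le hcost_ge0 andbT.
apply/lee_addgt0Pr => e e0; rewrite add0e.
pose r := Num.min 1 ((e / (K + 1)) `^ (s - t)^-1).
have K1 : 0 < K + 1 by rewrite ltr_wpDl.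
have r0 : 0 < r by rewrite lt_min ltr01/= powR_gt0// divr_gt0.
have [|M [P [Mle CP dP]]] := boxC r; first by rewrite r0/= /r ge_min lexx.
apply: (le_trans (@hcost_finite _ _ d s A M (fun l => P l `&` A) r _ r0 _ _)).
- by rewrite gt_eqF.
- by move=> x Ax; have [l lM Pl] := CP x (AC x Ax); exists l.
- by move=> l x y [Px Ax] [Py Ay]; rewrite (le_trans (dA x y Ax Ay))// (dP l).
rewrite lee_fin (le_trans (ler_wpM2r (powR_ge0 _ _) Mle))//.
rewrite -mulrA -powRD; last by rewrite (gt_eqF r0) implybT.
rewrite addrC.
have : r `^ (s - t) <= e / (K + 1).
  have st : s - t != 0 by rewrite gt_eqF ?subr_gt0.
  have -> : e / (K + 1) = ((e / (K + 1)) `^ (s - t)^-1) `^ (s - t).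
    by rewrite -powRrM mulVf// powRr1// divr_ge0 ?ltW.
  rewrite ge0_ler_powR// ?nnegrE ?powR_ge0 ?(ltW r0) ?subr_ge0 ?(ltW ts)//.
  by rewrite ge_min lexx orbT.
move/(ler_wpM2l K0)/le_trans; apply.
by rewrite mulrA ler_pdivrMr// mulrC ler_wpM2l ?lerDl// ltW.
Qed.

(** One time step through a set of box dimension [t] costs [t]: a set of size
    [r] for [dyn_dist n], pulled back by [phi], is cut by a cover of [C] at
    scale [r] into at most [K * r `^ (- t)] pieces of the same size for
    [dyn_dist n.+1], and the extra exponent [t] pays for their number. *)
Lemma hcost_pullback_box n (C : set N) (t s : R) : box_dim_le C t -> 0 <= t -> 0 < s ->
  hcost (dyn_dist phi n) s setT = 0 ->
  hcost (dyn_dist phi n.+1) (s + t) C = 0.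
Proof.
move=> [K K0 boxC] t0 s0 null; apply/eqP; rewrite eq_le hcost_ge0 andbT.
have K1 : 0 < K + 1 by rewrite ltr_wpDl.
apply/lee_addgt0Pr => e e0; rewrite add0e.
(* a total cost at most 1 keeps all sizes within the range of boxC *)
pose h := Num.min 1 (e / (K + 1)).
have h0 : 0 < h by rewrite lt_min ltr01/= divr_gt0.
have fnull : hcost (dyn_dist phi n) s setT \is a fin_num by rewrite null.
have [x [E [r [[r0 TE dE] ->]]]] := lb_ereal_inf_adherent h0 fnull.
rewrite -/(hcost _ _ _) null add0e => /ltW sumh.
have r1 i : r i <= 1.
  rewrite leNgt; apply/negP => ri1.
  have : ((r i `^ s)%:E <= h%:E)%E.
    rewrite (le_trans _ sumh)//.
    apply: le_trans (nneseries_lim_ge i.+1 _); last first.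
      by move=> k _ _; rewrite lee_fin powR_ge0.
    rewrite big_nat_recr//= leeDr// sume_ge0// => k _.
    by rewrite lee_fin powR_ge0.
  rewrite lee_fin leNgt => /negP; apply.
  have ris : 1 < r i `^ s.
    have := gt0_ltr_powR s0 (_ : 1 \in Num.nneg) (_ : r i \in Num.nneg) ri1.
    by rewrite powR1; apply; rewrite nnegrE.
  by rewrite (le_lt_trans _ ris)// /h ge_min lexx.
have -> : C = \bigcup_i (C `&` phi @^-1` E i).
  apply/seteqP; split=> [y Cy|y [i _ []]//].
  by have [i _ Ei] := TE (phi y) I; exists i.
rewrite (le_trans (hcost_bigcup _ _ _))//.
apply: (@le_trans _ _ (\sum_(i <oo) (K%:E * (r i `^ s)%:E))%E).
  apply: lee_nneseries => i _; first by move=> _; exact: hcost_ge0.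
  have := r0 i; rewrite le_eqVlt => /orP[/eqP ri0|ri].
    apply: (le_trans (@hcost_finite _ _ _ _ _ 0 (fun=> set0) 1 _ _ _ _)) => //.
    - by rewrite gt_eqF// ltr_wpDr.
    - by move=> y [_ Ey]; have [] := dE i _ _ Ey Ey; rewrite -ri0 ltxx.
    - by rewrite mul0r -EFinM lee_fin mulr_ge0 ?powR_ge0.
  have [|M [P [Mle CP dP]]] := boxC (r i); first by rewrite ri r1.
  apply: (le_trans (@hcost_finite _ _ _ _ _ M
    (fun l => P l `&` phi @^-1` E i) (r i) _ ri _ _)).
  - by rewrite gt_eqF// ltr_wpDr.
  - by move=> y [Cy Ey]; have [l lM Pl] := CP y Cy; exists l.
  - move=> l y z [Py Ey] [Pz Ez]; rewrite dyn_distS ge_max (dP l)//=.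
    by have [] := dE i _ _ Ey Ez.
  rewrite -EFinM lee_fin (le_trans (ler_wpM2r (powR_ge0 _ _) Mle))//.
  rewrite -mulrA -powRD; last by rewrite (gt_eqF ri) implybT.
  by rewrite addrCA addNr addr0.
rewrite nneseriesZl//; last by move=> i _; rewrite lee_fin powR_ge0.
apply: (le_trans (lee_wpmul2l _ sumh)) => //.
rewrite -EFinM lee_fin.
apply: (@le_trans _ _ (K * (e / (K + 1)))).
  by rewrite ler_wpM2l// ge_min lexx orbT.
by rewrite mulrA ler_pdivrMr// mulrC ler_wpM2l ?lerDl// ltW.
Qed.

(** One time step through an expanding piece is free: on it the distance of two
    points is controlled by the distance of their images, so the pulled back
    sets grow by a constant factor only. The index [n.+1] matters, since
    [dyn_dist 0] vanishes and controls nothing. *)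
Lemma hcost_pullback_expanding n (A : set N) (c s : R) : 0 < c -> 0 < s ->
  (forall x y, A x -> A y -> c * mdist x y <= mdist (phi x) (phi y)) ->
  hcost (dyn_dist phi n.+1) s setT = 0 ->
  hcost (dyn_dist phi n.+2) s A = 0.
Proof.
move=> c0 s0 exp null; apply/eqP; rewrite eq_le hcost_ge0 andbT.
apply/lee_addgt0Pr => e e0; rewrite add0e.
(* the constant must not exceed 1, as the old distances are divided by it too *)
pose b := Num.min c 1.
have b0 : 0 < b by rewrite lt_min c0 ltr01.
have bs0 : 0 < b `^ s by rewrite powR_gt0.
have fnull : hcost (dyn_dist phi n.+1) s setT \is a fin_num by rewrite null.
have [x [E [r [[r0 TE dE] ->]]]] := lb_ereal_inf_adherent (mulr_gt0 e0 bs0) fnull.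
rewrite -/(hcost _ _ _) null add0e => /ltW sumh.
apply: (@le_trans _ _ (\sum_(i <oo) (((b `^ s)^-1)%:E * (r i `^ s)%:E))%E); last first.
  rewrite nneseriesZl//; last by move=> i _; rewrite lee_fin powR_ge0.
  rewrite (le_trans (lee_wpmul2l _ sumh))//; first by rewrite lee_fin invr_ge0 ltW.
  by rewrite -EFinM lee_fin mulrC mulfK// gt_eqF.
apply: ereal_inf_lbound.
exists (fun i => A `&` phi @^-1` E i), (fun i => r i / b); split; first split.
- by move=> i; rewrite divr_ge0// ltW.
- by move=> y Ay; have [i _ Ei] := TE (phi y) I; exists i.
- move=> i y z [Ay Ey] [Az Ez]; have [ri dle] := dE i _ _ Ey Ez.
  split; first by rewrite divr_gt0.
  rewrite ler_pdivlMr// dyn_distS maxr_pMl ?(ltW b0)// ge_max; apply/andP; split.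
    rewrite (le_trans _ dle)// dyn_distS le_max; apply/orP; left.
    rewrite (le_trans _ (exp y z Ay Az))// mulrC ler_wpM2r ?mdist_ge0//.
    by rewrite /b ge_min lexx.
  rewrite (le_trans _ dle)// ler_piMr ?dyn_dist_ge0//.
  by rewrite /b ge_min lexx orbT.
apply: eq_eseriesr => i _.
by rewrite -EFinM powRM ?invr_ge0 ?(ltW b0)// -powRN mulrC -powR_inv1 ?(ltW b0)// -powRrM mulN1r.
Qed.

Definition constant_or_expanding (A : set N) :=
  (forall x y, A x -> A y -> phi x = phi y) \/
  (exists2 c : R, 0 < c &
     forall x y, A x -> A y -> c * mdist x y <= mdist (phi x) (phi y)).

(** Where [phi] is constant, two orbits merge after one step. *)
Lemma dyn_dist_eq_mdist n (A : set N) x y :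
  (forall x y, A x -> A y -> phi x = phi y) -> A x -> A y ->
  dyn_dist phi n.+1 x y = mdist x y.
Proof.
move=> Acst Ax Ay; rewrite dyn_distS (Acst x y)//.
have -> : dyn_dist phi n (phi y) (phi y) = 0.
  elim: n (phi y) => [|n IH] z; first by rewrite /dyn_dist big_ord0.
  by rewrite dyn_distS IH mdistxx maxxx.
by apply/max_idPl; rewrite mdist_ge0.
Qed.

(** Each of the [n] steps costs at most [a]; the last position, and every orbit
    that meets a piece of constancy, costs at most the dimension 1 of the space
    itself. *)
Lemma hcost_dyn_dist_null (C : set N) (B : nat -> set N) (a : R) n s :
  0 <= a -> box_dim_le [set: N] 1 -> box_dim_le C a ->
  [set: N] = C `|` \bigcup_i B i ->
  (forall i, constant_or_expanding (B i)) ->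
  n%:R * a + 1 < s -> hcost (dyn_dist phi n.+1) s setT = 0.
Proof.
move=> a0 box1 boxC NCB Bce; elim: n s => [|n IH] s.
  rewrite mul0r add0r => s1.
  apply: (hcost_box box1) => // [x y _ _|]; last by rewrite (lt_trans _ s1).
  by rewrite dyn_distS /dyn_dist big_ord0 ge_max lexx mdist_ge0.
move=> sn.
have sn' : n%:R * a + 1 < s - a by rewrite -natr1 mulrDl mul1r in sn; lra.
have na0 : 0 <= n%:R * a by rewrite mulr_ge0.
rewrite NCB; apply: hcost_null_setU.
  rewrite -(subrK a s); apply: hcost_pullback_box => //; first by lra.
  exact: IH.
apply: hcost_null_bigcup => i; have [Bcst|[c c0 cB]] := Bce i.
  apply: (hcost_box box1 (subsetT _)) => [x y Bx By||]; [|lra..].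
  by rewrite (dyn_dist_eq_mdist _ Bcst).
apply: (hcost_pullback_expanding c0 _ cB); first by lra.
by apply: IH; lra.
Qed.

Lemma dyn_diam_le n (A : set N) (r : R) : 0 <= r ->
  (forall x y, A x -> A y -> dyn_dist phi n x y <= r) ->
  (dyn_diam phi n A <= r%:E)%E.
Proof.
move=> r0 dA; rewrite ge_max lee_fin r0/=.
by apply: ge_ereal_sup => _ [[x y] [/= Ax Ay] <-]; rewrite lee_fin dA.
Qed.

(** A cover of small total cost automatically satisfies the size restriction
    [eps] in the definition of the content. *)
Lemma hausdorff_content_lt1 n (eps s : R) : 0 < eps -> 0 < s ->
  hcost (dyn_dist phi n) s setT = 0 ->
  (hausdorff_content phi n eps s < 1)%E.
Proof.
move=> e0 s0 null.
have fnull : hcost (dyn_dist phi n) s setT \is a fin_num by rewrite null.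
pose h := Num.min (eps `^ s) 2^-1.
have h0 : 0 < h by rewrite lt_min powR_gt0//= invr_gt0 ltr0n.
have [x [E [r [[r0 TE dE] ->]]]] := lb_ereal_inf_adherent h0 fnull.
rewrite -/(hcost _ _ _) null add0e => sumh.
have diamE i : (dyn_diam phi n (E i) <= (r i)%:E)%E.
  by apply: dyn_diam_le => // y z Ey Ez; have [] := dE i _ _ Ey Ez.
have powE i : (dyn_diam_pow phi n s (E i) <= (r i `^ s)%:E)%E.
  rewrite /dyn_diam_pow; case: ifP => _; first by rewrite lee_fin powR_ge0.
  rewrite -poweR_EFin; apply: gt0_ler_poweR (diamE i); first exact: ltW.
  - by rewrite in_itv/= leey andbT le_max lexx.
  - by rewrite in_itv/= leey andbT lee_fin.
have rle i : r i <= eps.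
  have : ((r i `^ s)%:E < (eps `^ s)%:E)%E.
    apply: (@lt_le_trans _ _ h%:E); last by rewrite lee_fin /h ge_min lexx.
    apply: le_lt_trans sumh.
    apply: le_trans (nneseries_lim_ge i.+1 _); last first.
      by move=> k _ _; rewrite lee_fin powR_ge0.
    rewrite big_nat_recr//= leeDr// sume_ge0// => k _.
    by rewrite lee_fin powR_ge0.
  rewrite lte_fin leNgt => rs; apply/negP => /ltW er.
  by move: rs; rewrite ltNge ge0_ler_powR// ?nnegrE ?(ltW e0)// ltW.
apply: (@le_lt_trans _ _ (h%:E)); last first.
  by rewrite lte_fin /h gt_min (_ : 2^-1 < 1 :> R) ?orbT// invf_lt1 ?ltr1n.
apply: le_trans (ltW sumh).
apply: (@le_trans _ _ (\sum_(0 <= i <oo) dyn_diam_pow phi n s (E i))%E).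
  apply: ereal_inf_lbound; exists E => //; split.
    by apply/seteqP; split.
  by move=> i; rewrite (le_trans (diamE i))// lee_fin.
apply: lee_nneseries => // i _ _; rewrite /dyn_diam_pow; case: ifP => // _.
exact: poweR_ge0.
Qed.

Theorem hausdorff_dim_le (C : set N) (B : nat -> set N) (a : R) n eps :
  0 <= a -> 0 < eps -> box_dim_le [set: N] 1 -> box_dim_le C a ->
  [set: N] = C `|` \bigcup_i B i ->
  (forall i, constant_or_expanding (B i)) ->
  (hausdorff_dim phi n.+1 eps <= (n%:R * a + 1)%:E)%E.
Proof.
move=> a0 e0 box1 boxC NCB Bce; apply: ge_ereal_sup => _ [s [s0 hs] <-].
rewrite lee_fin leNgt; apply/negP => sn.
move: hs; rewrite leNgt => /negP; apply; apply: hausdorff_content_lt1 => //.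
  by apply: lt_trans sn; rewrite ltr_wpDl// mulr_ge0.
exact: (hcost_dyn_dist_null a0 box1 boxC NCB Bce sn).
Qed.

End dynamical_null_sets.

(** * Covers of the binary sequences by cylinders *)

Section kraft.
Context {R : realType}.

(** The probability, for fair coin tosses [omega], that [omega] agrees with [v]
    on [F], conditionally on [omega] starting with [w]. *)
Definition cyl_mass (F : seq nat) (v : nat -> bool) (w : seq bool) : R :=
  if all (fun j => (j < size w)%N ==> (nth false w j == v j)) F
  then 2^-1 ^+ count (fun j => size w <= j)%N F else 0.

Lemma cyl_mass_ge0 F v w : 0 <= cyl_mass F v w.
Proof. by rewrite /cyl_mass; case: ifP => // _; rewrite exprn_ge0// invr_ge0. Qed.

Lemma cyl_mass_rcons F v w b : uniq F ->
  cyl_mass F v (rcons w b) =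
  if (size w \in F) then (if b == v (size w) then 2 * cyl_mass F v w else 0)
  else cyl_mass F v w.
Proof.
move=> uF; rewrite /cyl_mass size_rcons.
have allE : all (fun j => (j < (size w).+1)%N ==> (nth false (rcons w b) j == v j)) F =
    all (fun j => (j < size w)%N ==> (nth false w j == v j)) F &&
    ((size w \in F) ==> (b == v (size w))).
  apply/allP/andP => [H|[/allP H K] j jF]; first split.
  - apply/allP => j jF; apply/implyP => jw.
    by have := H j jF; rewrite nth_rcons jw ltnS (ltnW jw).
  - by apply/implyP => wF; have := H _ wF; rewrite nth_rcons ltnn eqxx ltnS leqnn.
  rewrite nth_rcons ltnS; have := H j jF.
  by case: ltngtP => //= jw _; rewrite jw in jF *; rewrite (implyP K).
have cntE : (count (fun j => size w <= j)%N F =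
    count (fun j => (size w).+1 <= j)%N F + (size w \in F))%N.
  rewrite -(count_uniq_mem _ uF) -[LHS]size_filter -[count (pred1 _) F]size_filter.
  rewrite -[count (fun j => _ < _)%N F]size_filter -size_cat; apply: perm_size.
  rewrite uniq_perm ?cat_uniq ?filter_uniq//=.
    rewrite andbT; apply/hasPn => j; rewrite !mem_filter => /andP[/= /eqP-> _].
    by rewrite ltnn.
  move=> j; rewrite mem_cat !mem_filter/= leq_eqVlt eq_sym.
  by case: (j \in F); rewrite ?andbF//= !andbT orbC.
rewrite allE cntE; case: (size w \in F) => /=; last by rewrite andbT addn0.
case: (b == _); rewrite ?andbF// andbT addn1; case: ifP => _; last by rewrite mulr0.
by rewrite exprS mulrA mulfV ?mul1r// pnatr_eq0.
Qed.

Lemma cyl_mass_split F v w : uniq F ->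
  cyl_mass F v w = 2^-1 * (cyl_mass F v (rcons w false) + cyl_mass F v (rcons w true)).
Proof.
move=> uF; rewrite !cyl_mass_rcons//; case: ifP => _; last by lra.
by case: (v _) => /=; lra.
Qed.

Lemma cyl_mass_nil F v : cyl_mass F v [::] = 2^-1 ^+ size F.
Proof.
rewrite /cyl_mass (_ : all _ F); last by apply/allP.
by rewrite (@eq_count _ _ predT)// count_predT.
Qed.

Local Open Scope ereal_scope.

(** Suppose that the total mass is less than 1. The conditional mass given a
    prefix is the mean of its values at the two extensions of the prefix, so
    digits can be chosen one after the other keeping the conditional total below
    1. The resulting sequence lies in some cylinder of the cover, whose
    conditional mass is eventually 1, a contradiction. *)
Lemma cylinder_cover_ge1 (F : nat -> seq nat) (v : nat -> nat -> bool) :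
  (forall i, uniq (F i)) ->
  (forall omega : nat -> bool,
     exists i, forall j, j \in F i -> omega j = v i j) ->
  1 <= \sum_(i <oo) (2^-1 ^+ size (F i) : R)%:E.
Proof.
move=> uF cov; rewrite leNgt; apply/negP => lt1.
pose tot w := \sum_(i <oo) (cyl_mass (F i) (v i) w)%:E.
have step w : tot w < 1 -> exists b, tot (rcons w b) < 1.
  move=> tw; have [t0|t0] := ltP (tot (rcons w false)) 1; first by exists false.
  have [t1|t1] := ltP (tot (rcons w true)) 1; first by exists true.
  exfalso; move: tw; rewrite ltNge => /negP; apply.
  rewrite /tot (eq_eseriesr (g := fun i => (2^-1)%:E *
    ((cyl_mass (F i) (v i) (rcons w false))%:E +
     (cyl_mass (F i) (v i) (rcons w true))%:E))); last first.
    by move=> i _; rewrite -EFinD -EFinM -cyl_mass_split.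
  rewrite nneseriesZl; last by move=> i _; rewrite adde_ge0// lee_fin cyl_mass_ge0.
  rewrite nneseriesD//; try by move=> i _ _; rewrite lee_fin cyl_mass_ge0.
  rewrite -/(tot _) -/(tot _).
  have : (2^-1)%:E * 2%:E <= (2^-1)%:E * (tot (rcons w false) + tot (rcons w true)).
    apply: lee_wpmul2l; first by rewrite lee_fin invr_ge0.
    by rewrite (_ : 2%:E = 1 + 1)%E ?leeD.
  by rewrite -EFinM mulVf// pnatr_eq0.
have /choice[b bP] w : exists b, tot w < 1 -> tot (rcons w b) < 1.
  have [/step[b tb]|_] := ltP (tot w) 1; first by exists b.
  by exists true.
(* the prefixes of the sequence escaping all cylinders *)
pose W := fix W n := if n is n'.+1 then rcons (W n') (b (W n')) else [::].
have sW n : size (W n) = n by elim: n => //= n IH; rewrite size_rcons IH.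
have tW n : tot (W n) < 1.
  elim: n => [|n IH]; last exact: bP.
  by rewrite /tot (eq_eseriesr (g := fun i => (2^-1 ^+ size (F i))%:E))// => i _;
    rewrite cyl_mass_nil.
have nW n j : (j < n)%N -> nth false (W n) j = b (W j).
  elim: n => // n IH; rewrite ltnS leq_eqVlt nth_rcons sW => /orP[/eqP->|jn].
    by rewrite ltnn eqxx.
  by rewrite jn IH.
have [i Fi] := cov (fun j => b (W j)).
have := tW (\max_(j <- F i) j).+1; rewrite ltNge => /negP; apply.
apply: le_trans (nneseries_lim_ge i.+1 _); last first.
  by move=> k _ _; rewrite lee_fin cyl_mass_ge0.
rewrite big_nat_recr//= addeC (@le_trans _ _ (cyl_mass (F i) (v i) (W (\max_(j <- F i) j).+1))%:E)//.
  rewrite /cyl_mass (_ : all _ _); last first.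
    by apply/allP => j jF; rewrite sW; apply/implyP => jm; rewrite nW// Fi.
  rewrite (_ : count _ _ = 0%N) ?expr0//.
  apply/eqP; rewrite -leqn0 leqNgt -has_count; apply/hasPn => j jF.
  by rewrite sW -ltnNge ltnS; exact: leq_bigmax_seq.
by rewrite leeDl// sume_ge0// => k _; rewrite lee_fin cyl_mass_ge0.
Qed.

End kraft.

(** * Lower bound for maps acting on digits *)

Lemma powR_invK (R : realType) (x p : R) : 0 < p -> 0 <= x ->
  (x `^ p^-1) `^ p = x.
Proof. by move=> p0 x0; rewrite -powRrM mulVf ?powRr1// gt_eqF. Qed.

(** [Pi] is a copy of the binary sequences on which [phi] acts by substituting
    indices along [m]. Points of [Pi] closer than [rho k] share their first [k]
    digits. Roots are indices that are not values of [m]; every index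
    [iter j m r] with [r] a root is reached in only one way, so different pairs
    [(j, r)] give independent digits. *)
Section symbolic_lower_bound.
Context {R : realType} {N : metricType R}.
Variables (phi : N -> N) (Pi : (nat -> bool) -> N).
Variables (m : nat -> nat) (root : pred nat) (rho : nat -> R) (s : R) (k0 : nat).
Hypothesis phiPi : forall omega, phi (Pi omega) = Pi (omega \o m).
Hypothesis m_inj : injective m.
Hypothesis root_m : forall i, ~~ root (m i).
Hypothesis rho_gt0 : forall k, 0 < rho k.
Hypothesis rho_noninc : {homo rho : i j / (i <= j)%N >-> j <= i}.
Hypothesis rho_cvg0 : forall e, 0 < e -> exists k, rho k <= e.
Hypothesis Pi_sep : forall k omega omega', mdist (Pi omega) (Pi omega') < rho k ->
  forall i, (i < k)%N -> omega i = omega' i.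
Hypothesis s_gt0 : 0 < s.
Hypothesis rate : forall k, (k0 <= k)%N ->
  2^-1 ^+ count root (iota 0 k) <= rho k.+1 `^ s.

(** The digits of [omega] that can be read off the first [k] digits of each of
    the points [Pi omega, ..., iter n.-1 phi (Pi omega)]. *)
Definition orbit_coords n k :=
  [seq iter j m r | r <- seq.filter root (iota 0 k), j <- iota 0 n].

Lemma iter_phi_Pi j omega : iter j phi (Pi omega) = Pi (omega \o iter j m).
Proof.
elim: j => [//|j IH]; rewrite iterS IH phiPi; congr Pi.
by apply/funext => i /=; rewrite -iterSr iterS.
Qed.

Lemma uniq_orbit_coords n k : uniq (orbit_coords n k).
Proof.
have iter_inj j j' r r' : root r -> root r' -> iter j m r = iter j' m r' ->
    r = r' /\ j = j'.
  move=> rr rr'; elim: j j' => [|j IH] [|j'] //=.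
  - by move=> rE; move: rr; rewrite rE (negbTE (root_m _)).
  - by move=> rE; move: rr'; rewrite -rE (negbTE (root_m _)).
  - by move=> /m_inj/IH[-> ->].
apply: allpairs_uniq; rewrite ?filter_uniq ?iota_uniq//.
move=> [r j] [r' j'] /allpairsP[[? ?] /= [+ _ [-> ->]]] /allpairsP[[? ?] /= [+ _ [-> ->]]].
by rewrite !mem_filter => /andP[rr _] /andP[rr' _] /(iter_inj _ _ _ _ rr rr')[-> ->].
Qed.

Lemma size_orbit_coords n k :
  size (orbit_coords n k) = (count root (iota 0 k) * n)%N.
Proof. by rewrite size_allpairs size_filter size_iota. Qed.

Lemma dyn_dist_iter n x y j : (j < n)%N ->
  mdist (iter j phi x) (iter j phi y) <= dyn_dist phi n x y.
Proof.
move=> jn; rewrite /dyn_dist.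
exact: (le_bigmax _ (fun i : 'I_n => mdist (iter i phi x) (iter i phi y)) (Ordinal jn)).
Qed.

Lemma orbit_coords_agree n k omega omega' :
  dyn_dist phi n (Pi omega) (Pi omega') < rho k ->
  forall i, i \in orbit_coords n k -> omega i = omega' i.
Proof.
move=> dlt i /allpairsP[[r j] /= [+ + ->]]; rewrite mem_filter !mem_iota/= !add0n.
move=> /andP[_ rk] jn; have := le_lt_trans (dyn_dist_iter _ _ jn) dlt.
by rewrite !iter_phi_Pi => /Pi_sep /(_ r rk).
Qed.

Lemma dyn_dist_le_diam n (A : set N) x y : A x -> A y ->
  ((dyn_dist phi n x y)%:E <= dyn_diam phi n A)%E.
Proof.
move=> Ax Ay; rewrite le_max; apply/orP; right.
by apply: ereal_sup_ubound; exists (x, y).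
Qed.

(** The mass distribution principle in combinatorial form: the part of [A] on
    the symbolic set lies in a cylinder whose mass is at most the cost of [A],
    up to an arbitrarily small error [eta]. The error is spent on the sets of
    diameter 0, which cost nothing while every cylinder has positive mass. *)
Lemma diam_pow_cylinder n (eps eta : R) (A : set N) : (0 < n)%N ->
  0 < eps < rho k0 -> 0 < eta -> (dyn_diam phi n A <= eps%:E)%E ->
  exists F v, [/\ uniq F,
    forall omega, A (Pi omega) -> forall j, j \in F -> omega j = v j &
    ((2^-1 ^+ size F)%:E <= dyn_diam_pow phi n (n%:R * s) A + eta%:E)%E].
Proof.
move=> n0 /andP[e0 elt] eta0 diamle.
have ns0 : 0 < n%:R * s by rewrite mulr_gt0// ltr0n.
have [D [D0 diamE]] : exists D : R, 0 <= D /\ dyn_diam phi n A = D%:E.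
  have d0 : (0 <= dyn_diam phi n A)%E by rewrite le_max lexx.
  have fin : dyn_diam phi n A \is a fin_num.
    by rewrite ge0_fin_numE// (le_lt_trans diamle) ?ltry.
  by exists (fine (dyn_diam phi n A)); rewrite fineK// fine_ge0.
have Deps : D <= eps by rewrite -lee_fin -diamE.
have pow0 : (0 <= dyn_diam_pow phi n (n%:R * s) A)%E.
  by rewrite /dyn_diam_pow; case: ifP => // _; exact: poweR_ge0.
have [r [r0 Dr reps rpow]] : exists r, [/\ 0 < r, D <= r, r <= eps &
    A !=set0 -> ((r `^ (n%:R * s))%:E <= dyn_diam_pow phi n (n%:R * s) A + eta%:E)%E].
  move: D0; rewrite le_eqVlt => /orP[/eqP D0|D0].
    exists (Num.min eps (eta `^ (n%:R * s)^-1)); split.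
    - by rewrite lt_min e0 powR_gt0.
    - by rewrite -D0 le_min ltW// powR_ge0.
    - by rewrite ge_min lexx.
    - move=> _; rewrite (@le_trans _ _ eta%:E)//; last by rewrite leeDr.
      rewrite lee_fin.
      rewrite -[leRHS](powR_invK ns0 (ltW eta0)).
      rewrite ge0_ler_powR ?(ltW ns0)// ?nnegrE ?powR_ge0//.
      + by rewrite le_min ltW// powR_ge0.
      + by rewrite ge_min lexx orbT.
  exists D; split => // A0; rewrite /dyn_diam_pow; case: eqP => [A_0|_].
    by move: A0; rewrite A_0 => -[].
  by rewrite diamE poweR_EFin leeDl// lee_fin ltW.
(* the largest number k of digits that the scale r still determines *)
have [k [k0k Drho kpow]] : exists k, [/\ (k0 <= k)%N, r < rho k & rho k.+1 <= r].
  have [|k rk kmin] := @ex_minnP (fun k => rho k <= r); first exact: rho_cvg0.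
  have kk0 : (k0 < k)%N.
    rewrite ltnNge; apply/negP => /rho_noninc kk0.
    by have := lt_le_trans elt kk0; rewrite ltNge (le_trans rk).
  case: k rk kmin kk0 => // k rk kmin kk0; exists k; split => //.
  by rewrite ltNge; apply/negP => /kmin; rewrite ltnn.
have [[omega0 A0]|noA] := pselect (exists omega, A (Pi omega)); last first.
  have [K Kle] : exists K, rho K <= eta `^ s^-1 by apply: rho_cvg0; rewrite powR_gt0.
  pose K' := maxn K k0.
  exists (seq.filter root (iota 0 K')), xpredT; split.
  - by rewrite filter_uniq ?iota_uniq.
  - by move=> omega Ao; exfalso; apply: noA; exists omega.
  - rewrite size_filter (@le_trans _ _ eta%:E)//; last by rewrite leeDr.
    rewrite lee_fin (le_trans (rate _))//; first exact: leq_maxr.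
    rewrite -[leRHS](powR_invK s_gt0 (ltW eta0)).
    rewrite ge0_ler_powR ?(ltW s_gt0)// ?nnegrE ?powR_ge0// ?(ltW (rho_gt0 _))//.
    by rewrite (le_trans _ Kle)// rho_noninc// ltnW// ltnS leq_maxl.
exists (orbit_coords n k), omega0; split.
- exact: uniq_orbit_coords.
- move=> omega Ao; apply: (@orbit_coords_agree n k).
  apply: le_lt_trans Drho; rewrite (le_trans _ Dr)// -lee_fin -diamE.
  exact: dyn_dist_le_diam.
- have An0 : A !=set0 by exists (Pi omega0).
  rewrite (le_trans _ (rpow An0))// lee_fin size_orbit_coords.
  rewrite exprM mulrC powRrM -powR_mulrn ?powR_ge0//.
  rewrite powR_mulrn ?powR_ge0// powR_mulrn ?powR_ge0//.
  rewrite lerXn2r// ?nnegrE ?powR_ge0// ?exprn_ge0 ?invr_ge0//.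
  rewrite (le_trans (rate k0k))//.
  by rewrite ge0_ler_powR// ?nnegrE ?(ltW s_gt0) ?(ltW r0) ?(ltW (rho_gt0 _)).
Qed.

Theorem hausdorff_dim_ge n (eps : R) : (0 < n)%N -> 0 < eps < rho k0 ->
  ((n%:R * s)%:E <= hausdorff_dim phi n eps)%E.
Proof.
move=> n0 ebd; apply: ereal_sup_ubound; exists (n%:R * s) => //.
split; first by rewrite mulr_ge0// ltW.
apply: le_ereal_inf_tmp => _ [E [Ecov Ediam] <-].
apply/lee_addgt0Pr => eta eta0.
pose S := (\sum_(0 <= i <oo) dyn_diam_pow phi n (n%:R * s) (E i))%E.
have eta_i i : 0 < eta / (2 ^ i.+1)%:R by rewrite divr_gt0// ltr0n expn_gt0.
have /choice[Fv FvP] i := let: ex_intro F (ex_intro v P) :=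
  diam_pow_cylinder n0 ebd (eta_i i) (Ediam i) in
  ex_intro (fun Fv : seq nat * (nat -> bool) => [/\ uniq Fv.1,
    forall omega, E i (Pi omega) -> forall j, j \in Fv.1 -> omega j = Fv.2 j &
    ((2^-1 ^+ size Fv.1)%:E <= dyn_diam_pow phi n (n%:R * s) (E i)
        + (eta / (2 ^ i.+1)%:R)%:E)%E]) (F, v) P.
have := @cylinder_cover_ge1 R (fun i => (Fv i).1) (fun i => (Fv i).2) _ _.
move=> /(_ _ _)/le_trans; apply.
- by move=> i; have [] := FvP i.
- move=> omega; have : [set: N] (Pi omega) by [].
  rewrite -Ecov => -[i _ Ei]; exists i; have [_ + _] := FvP i.
  exact.
have pow0 i : (0 <= dyn_diam_pow phi n (n%:R * s) (E i))%E.
  by rewrite /dyn_diam_pow; case: ifP => // _; exact: poweR_ge0.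
apply: (le_trans _ (epsilon_trick _ _ (ltW eta0))) => //.
apply: lee_nneseries => i _; first by rewrite lee_fin exprn_ge0// invr_ge0.
by have [] := FvP i.
Qed.

End symbolic_lower_bound.

(** * From bounds at finite scales to mean Hausdorff dimension *)

Section mean_dimension_limits.
Context {R : realType} {N : metricType R}.
Variable phi : N -> N.
Local Open Scope ereal_scope.

Lemma limn_esup_le_near (u : (\bar R)^nat) b :
  (\forall n \near \oo, u n <= b) -> limn_esup u <= b.
Proof.
move=> ub; apply: (@le_trans _ _ (ereal_sup (u @` [set n | u n <= b]))).
  by apply: ereal_inf_lbound; exists [set n | u n <= b].
by apply: ge_ereal_sup => _ [n /= un <-].
Qed.

Lemma limn_einf_ge_near (u : (\bar R)^nat) b :
  (\forall n \near \oo, b <= u n) -> b <= limn_einf u.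
Proof.
move=> ub; rewrite /limn_einf leeNr; apply: limn_esup_le_near.
by apply: filterS ub => n; rewrite leeN2.
Qed.

(** With exponent 0 every nonempty set of a cover costs 1; so the supremum
    defining the dimension is over a nonempty set. *)
Lemma hausdorff_dim_ge0 (x0 : N) n eps : 0 <= hausdorff_dim phi n eps.
Proof.
apply: ereal_sup_ubound; exists 0%R => //; split => //.
apply: le_ereal_inf_tmp => _ [E [Ecov _] <-].
have [i _ Ei] : (\bigcup_i E i) x0 by rewrite Ecov.
have pow0 j : 0 <= dyn_diam_pow phi n 0 (E j).
  by rewrite /dyn_diam_pow; case: ifP => // _; exact: poweR_ge0.
apply: le_trans (nneseries_lim_ge i.+1 _); last by move=> k _ _.
rewrite big_nat_recr//= -[leLHS]add0e leeD ?sume_ge0//.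
rewrite /dyn_diam_pow; case: eqP => [Ei0|_]; last by rewrite poweRe0.
by move: Ei; rewrite Ei0.
Qed.

Theorem mdimH_eq (a : R) : N -> (0 <= a)%R ->
  (forall n eps, (0 < eps)%R -> hausdorff_dim phi n.+1 eps <= (n%:R * a + 1)%:E) ->
  (forall s, (0 < s < a)%R -> exists2 e0 : R, (0 < e0)%R & forall n eps,
     (0 < n)%N -> (0 < eps < e0)%R -> (n%:R * s)%:E <= hausdorff_dim phi n eps) ->
  upper_mdimH phi = a%:E /\ lower_mdimH phi = a%:E.
Proof.
move=> x0 a0 upper lower.
pose u eps n := (n%:R^-1)%:E * hausdorff_dim phi n eps.
have hi eps : (0 < eps)%R -> limn_esup (u eps) <= a%:E.
  move=> eps0; apply/lee_addgt0Pr => e e0; apply: limn_esup_le_near.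
  exists (Num.bound e^-1).+1 => // -[|n] //= nb.
  rewrite /u (le_trans (lee_wpmul2l _ (upper n eps eps0)))//.
  rewrite -EFinM lee_fin mulrC ler_pdivrMr ?ltr0n//.
  have eb : (e^-1 < (Num.bound e^-1)%:R)%R.
    by apply: archi_boundP; rewrite invr_ge0 ltW.
  have en : (e^-1 <= n.+1%:R)%R by rewrite (le_trans (ltW eb))// ler_nat ltnW.
  have : (1 <= e * n.+1%:R)%R by rewrite -ler_pdivrMl// mulr1.
  have : (0 <= n%:R :> R)%R by [].
  by rewrite -natr1; nra.
have lo s : (s < a)%R -> \forall eps \near 0^'+, s%:E <= limn_einf (u eps).
  move=> sa; have [s0|s0] := leP s 0%R.
    apply: nearW => eps; apply: limn_einf_ge_near; apply: nearW => n.
    apply: (@le_trans _ _ 0); first by rewrite lee_fin.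
    by apply: mule_ge0; [rewrite lee_fin invr_ge0|exact: hausdorff_dim_ge0 x0 _ _].
  have [|e0 e00 H] := lower s; first by rewrite s0.
  near=> eps; apply: limn_einf_ge_near; exists 1%N => // n /= n1.
  have n0 : (n%:R != 0 :> R)%R by rewrite pnatr_eq0 -lt0n.
  rewrite /u -[s](mulKf n0) EFinM lee_wpmul2l ?lee_fin ?invr_ge0//.
  by apply: H => //; apply/andP; split; near: eps;
    [exact: nbhs_right_gt|exact: nbhs_right_lt].
have cvga (g : R -> \bar R) :
    (forall eps, (0 < eps)%R -> g eps <= a%:E) ->
    (forall s, (s < a)%R -> \forall eps \near 0^'+, s%:E <= g eps) ->
    lim (g @ 0^'+) = a%:E.
  move=> ghi glo; apply/cvg_lim => //; apply/fine_cvgP; split.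
    have /glo : (a - 1 < a)%R by lra.
    move=> lo1; near=> eps.
    rewrite fin_numE -ltNye -ltey; apply/andP; split.
      by apply: (@lt_le_trans _ _ (a - 1)%:E); [exact: ltNyr|near: eps].
    apply: (@le_lt_trans _ _ a%:E); last exact: ltry.
    by apply: ghi; near: eps; exact: nbhs_right_gt.
  apply/cvgrPdist_le => e e0; have /glo lo1 : (a - e < a)%R by lra.
  near=> eps.
  have g1 : (a - e)%:E <= g eps by near: eps.
  have g2 : g eps <= a%:E by apply: ghi; near: eps; exact: nbhs_right_gt.
  have gf : g eps \is a fin_num.
    rewrite fin_numE -ltNye -ltey (lt_le_trans _ g1) ?ltNyr//=.
    by rewrite (le_lt_trans g2) ?ltry.
  move: g1 g2; rewrite /= -(fineK gf) !lee_fin/= => g1 g2.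
  by rewrite ger0_norm; lra.
split; apply: cvga.
- exact: hi.
- move=> s /lo; apply: filterS => eps /le_trans; apply; exact: limn_einf_sup.
- by move=> eps /hi; apply: le_trans; exact: limn_einf_sup.
- exact: lo.
Unshelve. all: by end_near. Qed.

End mean_dimension_limits.

(** * The Cantor set and its digit functions *)

Section clamp.
Context {R : realType}.

Definition clamp (x : R) : R := Num.max 0 (Num.min 1 x).

Lemma clamp_01 x : 0 <= clamp x <= 1.
Proof. by rewrite /clamp le_max lexx/= ge_max ler01 ge_min lexx. Qed.

Lemma clamp_le0 x : x <= 0 -> clamp x = 0.
Proof.
move=> x0; rewrite /clamp; apply/max_idPl; rewrite ge_min x0 orbT//.
Qed.

Lemma clamp_ge1 x : 1 <= x -> clamp x = 1.
Proof. by move=> x1; rewrite /clamp (min_idPl x1); apply/max_idPr. Qed.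

Lemma clamp_id x : 0 <= x <= 1 -> clamp x = x.
Proof. by move=> /andP[x0 x1]; rewrite /clamp (min_idPr x1); apply/max_idPr. Qed.

Lemma clamp_continuous : continuous clamp.
Proof.
move=> x; apply: continuous_max; first exact: cvg_cst.
by apply: continuous_min; [exact: cvg_cst|exact: cvg_id].
Qed.

End clamp.

Section cantor_model.
Context {R : realType}.
Variable lam : R.
Hypothesis lam_gt0 : 0 < lam.
Hypothesis lam_le_half : 2 * lam <= 1.

(** The Cantor set has [2 ^ k] pieces of length [len k] at level [k]. The factor
    [1 / k.+1] leaves a gap between neighbouring pieces even when [lam] is 1/2,
    and disappears in the logarithmic scale, so that the dimension is that
    given by [lam] alone. *)
Definition len k : R := lam ^+ k / k.+1%:R.
(** A nonincreasing lower bound for [gap k]. *)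
Definition sep k : R := lam ^+ k / (k.+1%:R * k.+2%:R).
(** The distance between the left ends of two sibling pieces of level [k.+1]. *)
Definition shift k : R := len k - len k.+1.
Definition gap k : R := shift k - len k.+1.

Let lamX_gt0 k : 0 < lam ^+ k. Proof. exact: exprn_gt0. Qed.

Lemma len0 : len 0 = 1. Proof. by rewrite /len expr0 divr1. Qed.

Lemma len_gt0 k : 0 < len k.
Proof. by rewrite divr_gt0. Qed.

Lemma sep_gt0 k : 0 < sep k.
Proof. by rewrite divr_gt0// mulr_gt0. Qed.

Lemma sep_le_gap k : sep k <= gap k.
Proof.
have -> : sep k = lam ^+ k * (k.+1%:R^-1 - k.+2%:R^-1).
  rewrite /sep; congr (_ * _); rewrite -[k.+2%:R]natr1.
  have : 0 < k.+1%:R :> R by [].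
  by move: k.+1%:R => p p0; field; apply/andP; split; rewrite gt_eqF//; lra.
have -> : gap k = lam ^+ k * (k.+1%:R^-1 - (2 * lam) * k.+2%:R^-1).
  by rewrite /gap /shift /len exprS; ring.
rewrite ler_wpM2l ?(ltW (lamX_gt0 _))// lerD2l lerN2.
by rewrite ler_piMl// invr_ge0.
Qed.

Lemma gap_gt0 k : 0 < gap k.
Proof. exact: lt_le_trans (sep_gt0 k) (sep_le_gap k). Qed.

Lemma shift_gt0 k : 0 < shift k.
Proof. by have := gap_gt0 k; have := len_gt0 k.+1; rewrite /gap; lra. Qed.

Let lam_le1 : lam <= 1. Proof. by move: lam_gt0 lam_le_half; lra. Qed.

Lemma sep_noninc : {homo sep : i j / (i <= j)%N >-> j <= i}.
Proof.
move=> i j ij; rewrite /sep ler_pM ?invr_ge0// ?(ltW (lamX_gt0 _))//.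
  by rewrite ler_wiXn2l// ltW.
by rewrite lef_pV2 ?posrE ?mulr_gt0// -!natrM ler_nat leq_mul.
Qed.

Lemma len_le_lamX k : len k <= lam ^+ k.
Proof. by rewrite ler_pdivrMr// ler_peMr ?(ltW (lamX_gt0 _))// ler1n. Qed.

Lemma len_small (e : R) : 0 < e -> exists k, len k <= e.
Proof.
move=> e0; have := archi_boundP (ltW (_ : 0 < e^-1)); rewrite invr_gt0 => /(_ e0).
set k := Num.bound _ => ek; exists k.
rewrite (@le_trans _ _ k.+1%:R^-1)//; last first.
  rewrite -[leRHS]invrK lef_pV2 ?posrE ?invr_gt0//.
  by rewrite (le_trans (ltW ek))// ler_nat.
by rewrite /len ler_piMl// exprn_ile1// ltW.
Qed.

Lemma sep_small (e : R) : 0 < e -> exists k, sep k <= e.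
Proof.
move=> /len_small[k ke]; exists k; rewrite (le_trans _ ke)// ler_wpM2l ?(ltW (lamX_gt0 _))//.
by rewrite lef_pV2 ?posrE ?mulr_gt0// ler_peMr// ler1n.
Qed.

(** The point whose digits from level [t] on are [u]; the digits are allowed to
    be real numbers in [0, 1], so that they can vary continuously. *)
Definition digit_sum t (u : nat -> R) : R :=
  limn (series (fun i => shift (t + i) * u i)).

Definition in01 (u : nat -> R) := forall i, 0 <= u i <= 1.

Lemma digit_sum_cvg t u : in01 u ->
  cvgn (series (fun i => shift (t + i) * u i)).
Proof.
move=> u01; apply: nondecreasing_is_cvgn.
  apply: nondecreasing_series => n _ _; have /andP[un0 _] := u01 n.
  by rewrite mulr_ge0// ltW// shift_gt0.
exists (len t) => _ [n _ <-]; rewrite /series/=.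
suff: \sum_(0 <= k < n) shift (t + k) * u k <= len t - len (t + n).
  by have := len_gt0 (t + n); lra.
elim: n => [|n IH]; first by rewrite big_nil addn0 subrr.
rewrite big_nat_recr//= addnS; have /andP[un0 un1] := u01 n.
have : shift (t + n) * u n <= shift (t + n) by rewrite ler_piMr// ltW// shift_gt0.
by rewrite {2}/shift; lra.
Qed.

Lemma digit_sumS t u : in01 u ->
  digit_sum t u = shift t * u 0%N + digit_sum t.+1 (u \o S).
Proof.
move=> u01; apply/cvg_lim => //; rewrite -cvg_shiftS.
have -> : (fun n => series (fun i => shift (t + i) * u i) n.+1) =
    (fun n => shift t * u 0%N + series (fun i => shift (t.+1 + i) * (u \o S) i) n).
  apply/funext => n; rewrite /series/= big_nat_recl//= addn0; congr (_ + _).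
  by apply: eq_bigr => i _; rewrite addnS.
apply: cvgD; first exact: cvg_cst.
by apply: digit_sum_cvg => i; exact: u01.
Qed.

Lemma digit_sum_ge0 t u : in01 u -> 0 <= digit_sum t u.
Proof.
move=> u01; apply: limr_ge; first exact: digit_sum_cvg.
apply: nearW => n; rewrite /series/= sumr_ge0// => i _.
by have /andP[? _] := u01 i; rewrite mulr_ge0// ltW// shift_gt0.
Qed.

Lemma digit_sum_split k t u : in01 u ->
  digit_sum t u = \sum_(i < k) shift (t + i) * u i +
                  digit_sum (t + k) (fun i => u (k + i)%N).
Proof.
move=> u01; elim: k => [|k IH]; first by rewrite big_ord0 add0r addn0.
rewrite big_ord_recr/= -addrA {}IH; congr (_ + _); rewrite digit_sumS ?addn0 ?addnS//.
by congr (_ + digit_sum _ _); apply/funext => i /=; rewrite addSnnS.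
Qed.

Lemma sum_shift k t : \sum_(i < k) shift (t + i) = len t - len (t + k).
Proof.
elim: k => [|k IH]; first by rewrite big_ord0 addn0 subrr.
by rewrite big_ord_recr/= IH addnS /shift; lra.
Qed.

Lemma digit_sum_le t u : in01 u -> digit_sum t u <= len t.
Proof.
move=> u01; apply: limr_le; first exact: digit_sum_cvg.
apply: nearW => n; rewrite /series/= big_mkord.
apply: (@le_trans _ _ (\sum_(i < n) shift (t + i))).
  apply: ler_sum => i _; have /andP[_ ?] := u01 i.
  by rewrite ler_piMr// ltW// shift_gt0.
by rewrite sum_shift; have := len_gt0 (t + n); lra.
Qed.

Lemma digit_sum_approx k u : in01 u ->
  `|digit_sum 0 u - \sum_(i < k) shift i * u i| <= len k.
Proof.
move=> u01; rewrite (digit_sum_split k)// add0n.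
have u01' : in01 (fun i => u (k + i)%N) by move=> i; exact: u01.
have -> (a b : R) : a + b - a = b by lra.
by rewrite ger0_norm ?digit_sum_ge0// digit_sum_le.
Qed.

Lemma digit_sum1 : digit_sum 0 (fun=> 1) = 1.
Proof.
have i01 : in01 (fun=> 1) by move=> i; rewrite ler01 lexx.
apply/eqP; rewrite eq_le; apply/andP; split.
  by rewrite -[leRHS]len0 digit_sum_le.
apply/ler_addgt0Pr => e e0; have [|k ke] := @len_small (e / 2); first exact: divr_gt0.
have := digit_sum_approx k i01.
under eq_bigr do rewrite mulr1.
rewrite (eq_bigr (fun i : 'I_k => shift (0 + i)))// sum_shift len0 add0n.
by rewrite ler_norml => /andP[+ _]; lra.
Qed.

Lemma digit_sum0 : digit_sum 0 (fun=> 0) = 0.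
Proof.
apply/cvg_lim => //; rewrite (_ : series _ = fun=> 0); first exact: cvg_cst.
by apply/funext => n; rewrite /series/= big1// => i _; rewrite mulr0.
Qed.

(** The form in which affinity of the digits passes to the sum. *)
Lemma digit_sum_linear u v u' v' (p q : R) :
  in01 u -> in01 v -> in01 u' -> in01 v' ->
  (forall i, (u i - v i) * p = q * (u' i - v' i)) ->
  (digit_sum 0 u - digit_sum 0 v) * p = q * (digit_sum 0 u' - digit_sum 0 v').
Proof.
move=> u01 v01 u'01 v'01 H.
pose S w := series (fun i => shift (0 + i) * w i).
have SE : (fun n => (S u n - S v n) * p) = (fun n => q * (S u' n - S v' n)).
  apply/funext => n; rewrite /S /series/= -!sumrB mulr_suml mulr_sumr.
  apply: eq_bigr => i _; rewrite -!mulrBr -mulrA H; lra.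
have cvgl : (S u n - S v n) * p @[n --> \oo] -->
    (digit_sum 0 u - digit_sum 0 v) * p.
  apply: cvgM; last exact: cvg_cst.
  by apply: cvgB; exact: digit_sum_cvg.
have cvgr : (S u n - S v n) * p @[n --> \oo] -->
    q * (digit_sum 0 u' - digit_sum 0 v').
  rewrite SE; apply: cvgM; first exact: cvg_cst.
  by apply: cvgB; exact: digit_sum_cvg.
by rewrite -(cvg_lim (@Rhausdorff R) cvgl) (cvg_lim (@Rhausdorff R) cvgr).
Qed.


(** The first digit at level [t]: 0 on the left piece, 1 on the right one, linear
    on the gap between them. *)
Definition ramp t x := clamp ((x - len t.+1) / gap t).

(** The [j]-th digit after level [t], extended from the Cantor set to the line.
    Outside the piece [0, len t] a digit is constant, 0 to the left and 1 to the
    right, so that one formula covers both siblings: on the left one the last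
    two terms vanish, on the right one the first two cancel, and on the gap what
    remains is [1 - ramp t x], which joins the digit 1 at the right end of the
    left piece to the digit 0 at the left end of the right piece. *)
Fixpoint digit j t x := if j is j'.+1
  then digit j' t.+1 x - ramp t x + digit j' t.+1 (x - shift t)
  else ramp t x.

Lemma ramp_left t x : x <= len t.+1 -> ramp t x = 0.
Proof.
move=> xl; rewrite /ramp clamp_le0// pmulr_lle0 ?invr_gt0 ?gap_gt0//.
by rewrite subr_le0.
Qed.

Lemma ramp_right t x : shift t <= x -> ramp t x = 1.
Proof.
by move=> xl; rewrite /ramp clamp_ge1// ler_pdivlMr ?gap_gt0// mul1r lerB.
Qed.

Lemma ramp_mid t x : len t.+1 <= x <= shift t -> ramp t x = (x - len t.+1) / gap t.
Proof.
move=> /andP[lx xs]; rewrite /ramp clamp_id//; apply/andP; split.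
  by apply: divr_ge0; [rewrite subr_ge0|exact: ltW (gap_gt0 _)].
by rewrite ler_pdivrMr ?gap_gt0// mul1r lerB.
Qed.

Lemma digit_le0 j t x : x <= 0 -> digit j t x = 0.
Proof.
elim: j t x => [|j IH] t x x0 /=.
  by rewrite ramp_left// (le_trans x0)// ltW// len_gt0.
rewrite !IH//; last by rewrite subr_le0 (le_trans x0)// ltW// shift_gt0.
by rewrite ramp_left ?subr0 ?addr0// (le_trans x0)// ltW// len_gt0.
Qed.

Let len_le_shift t : len t.+1 <= shift t.
Proof. by move: (gap_gt0 t); rewrite /gap; lra. Qed.

Let shift_addl t : shift t + len t.+1 = len t.
Proof. by rewrite /shift; lra. Qed.

Lemma digit_ge_len j t x : len t <= x -> digit j t x = 1.
Proof.
elim: j t x => [|j IH] t x tx; have := shift_addl t; have := len_le_shift t;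
  have := len_gt0 t.+1 => l1 l2 l3 /=.
  by rewrite ramp_right//; lra.
by rewrite !IH ?ramp_right; lra.
Qed.

Lemma digit_left j t x : x <= len t.+1 -> digit j.+1 t x = digit j t.+1 x.
Proof.
move=> xl /=; rewrite ramp_left// subr0 [X in _ + X]digit_le0 ?addr0// subr_le0.
exact: le_trans (len_le_shift t).
Qed.

Lemma digit_right j t x : shift t <= x ->
  digit j.+1 t x = digit j t.+1 (x - shift t).
Proof.
move=> sx /=; rewrite ramp_right// (@digit_ge_len j t.+1 x) ?subrr ?add0r//.
exact: le_trans (len_le_shift t) sx.
Qed.

Lemma digit_mid j t x : len t.+1 <= x <= shift t ->
  digit j.+1 t x = 1 - ramp t x.
Proof.
move=> /andP[lx xs] /=.
rewrite (@digit_ge_len j t.+1 x)// (@digit_le0 j t.+1 (x - shift t)) ?addr0//.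
by rewrite subr_le0.
Qed.

Lemma digit_01 j t x : 0 <= digit j t x <= 1.
Proof.
elim: j t x => [|j IH] t x; first exact: clamp_01.
have [xl|lx] := leP x (len t.+1); first by rewrite digit_left.
have [sx|xs] := leP (shift t) x; first by rewrite digit_right.
rewrite digit_mid; last by rewrite !ltW.
by have /andP[] := clamp_01 ((x - len t.+1) / gap t); rewrite -/(ramp t x); lra.
Qed.

Lemma ramp_continuous t : continuous (ramp t).
Proof.
move=> x.
apply: (@continuous_comp _ _ _ (fun y => (y - len t.+1) / gap t) clamp);
  last exact: clamp_continuous.
apply: cvgM; last exact: cvg_cst.
by apply: cvgB; [exact: cvg_id|exact: cvg_cst].
Qed.

Lemma digit_continuous j t : continuous (digit j t).
Proof.
elim: j t => [|j IH] t /=; first exact: ramp_continuous.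
move=> x; apply: cvgD; first by apply: cvgB; [exact: IH|exact: ramp_continuous].
apply: (@continuous_comp _ _ _ (fun y => y - shift t) (digit j t.+1)); last exact: IH.
by apply: cvgB; [exact: cvg_id|exact: cvg_cst].
Qed.

Definition cantor_pt t (omega : nat -> bool) : R := digit_sum t (fun i => (omega i)%:R).

Let in01_bool (omega : nat -> bool) : in01 (fun i => (omega i)%:R : R).
Proof. by move=> i; case: (omega i); rewrite ?lexx ?ler01. Qed.

Lemma cantor_ptS t omega :
  cantor_pt t omega = shift t * (omega 0%N)%:R + cantor_pt t.+1 (omega \o S).
Proof. by rewrite /cantor_pt digit_sumS. Qed.

Lemma cantor_pt_ge0 t omega : 0 <= cantor_pt t omega.
Proof. exact: digit_sum_ge0. Qed.

Lemma cantor_pt_le t omega : cantor_pt t omega <= len t.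
Proof. exact: digit_sum_le. Qed.

Lemma digit_cantor_pt j t omega : digit j t (cantor_pt t omega) = (omega j)%:R.
Proof.
elim: j t omega => [|j IH] t omega; rewrite cantor_ptS.
  case: (omega 0%N); rewrite ?mulr1 ?mulr0 ?add0r/=.
    by rewrite ramp_right// lerDl cantor_pt_ge0.
  by rewrite ramp_left ?cantor_pt_le.
case: (omega 0%N); rewrite ?mulr1 ?mulr0 ?add0r/=.
  by rewrite -[LHS]/(digit j.+1 _ _) digit_right ?lerDl ?cantor_pt_ge0// addrC addKr IH.
by rewrite -[LHS]/(digit j.+1 _ _) digit_left ?cantor_pt_le// IH.
Qed.

Lemma cantor_pt_sep0 t omega omega' : omega 0%N != omega' 0%N ->
  sep t <= `|cantor_pt t omega - cantor_pt t omega'|.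
Proof.
have far x y : 0 <= x <= len t.+1 -> 0 <= y <= len t.+1 ->
    gap t <= `|shift t + x - y|.
  move=> /andP[x0 x1] /andP[y0 y1]; rewrite (le_trans _ (ler_norm _))//.
  by rewrite /gap; lra.
have b01 o : 0 <= cantor_pt t.+1 o <= len t.+1 by rewrite cantor_pt_ge0 cantor_pt_le.
move=> ne; apply: (le_trans (sep_le_gap t)); rewrite (cantor_ptS t omega) (cantor_ptS t omega').
case: (omega 0%N) (omega' 0%N) ne => -[] // _.
  by rewrite mulr1 mulr0 add0r far.
by rewrite mulr1 mulr0 add0r distrC far.
Qed.

(** Sequences that differ at [i] first differ at some index up to [i], where a gap
    of at least the same bound separates them. *)
Lemma cantor_pt_sep i t omega omega' : omega i != omega' i ->
  sep (t + i) <= `|cantor_pt t omega - cantor_pt t omega'|.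
Proof.
elim: i t omega omega' => [|i IH] t omega omega' ne.
  by rewrite addn0; exact: cantor_pt_sep0.
have [eq0|ne0] := eqVneq (omega 0%N) (omega' 0%N).
  rewrite (cantor_ptS t omega) (cantor_ptS t omega') eq0 -addSnnS.
  have -> (a b c : R) : a + b - (a + c) = b - c by lra.
  exact: IH.
by rewrite (le_trans _ (cantor_pt_sep0 t ne0))// sep_noninc// leq_addr.
Qed.

(** The left end of the piece with digits [w]. *)
Fixpoint offset t (w : seq bool) : R :=
  if w is b :: w' then shift t * b%:R + offset t.+1 w' else 0.

Definition gap_set t w : set R :=
  [set x | offset t w + len (t + size w).+1 < x < offset t w + shift (t + size w)].

Lemma offset_bound t w : 0 <= offset t w /\ offset t w + len (t + size w) <= len t.
Proof.
elim: w t => [|b w IH] t /=; first by rewrite addn0 add0r.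
have [IH0 IH1] := IH t.+1; rewrite -addSnnS.
have h1 := shift_addl t; have h2 := len_le_shift t; have h3 := shift_gt0 t.
by case: b; rewrite ?mulr1 ?mulr0; split; lra.
Qed.

Lemma gap_set_cons t b w x :
  gap_set t (b :: w) x = gap_set t.+1 w (x - shift t * b%:R).
Proof.
rewrite /gap_set/= -addSnnS ltrBrDl ltrBlDl.
by rewrite [in RHS]addrA [in RHS](addrA (shift t * b%:R) (offset _ _) (shift _)).
Qed.

Lemma gap_set_bound t w x : gap_set t w x -> 0 <= x <= len t.
Proof.
move=> /andP[x1 x2]; have [ofs0 ofs1] := offset_bound t w.
have h1 := shift_addl (t + size w); have h2 := len_gt0 (t + size w).+1.
by apply/andP; split; lra.
Qed.

(** A point in no gap can be located in a piece of every level; this replaces a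
    coding of the Cantor set by infinite sequences. *)
Lemma outside_gaps k t (x : R) : 0 <= x <= len t -> (forall w, ~ gap_set t w x) ->
  exists w, size w = k /\ offset t w <= x <= offset t w + len (t + k).
Proof.
elim: k t x => [|k IH] t x x01 nG; first by exists [::]; rewrite addn0 add0r.
have xb (b : bool) : 0 <= x - shift t * b%:R <= len t.+1 -> exists w, size w = k.+1 /\
    offset t w <= x <= offset t w + len (t + k.+1).
  move=> xb; have [|w [sw wx]] := IH t.+1 _ xb.
    by move=> w Gw; apply: (nG (b :: w)); rewrite gap_set_cons.
  exists (b :: w); rewrite /= sw -addSnnS; split => //; move: wx => /andP[w1 w2];
    apply/andP; split; lra.
have stl := shift_addl t.
have [xl|lx] := leP x (len t.+1); first by apply: (xb false); rewrite mulr0; lra.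
have [sx|xs] := leP (shift t) x; first by apply: (xb true); rewrite mulr1; lra.
by exfalso; apply: (nG [::]); rewrite /gap_set/= addn0 !add0r lx xs.
Qed.

(** Affinity on a set, in the cross-multiplied form that does not mention the
    slope and passes to sums and limits. *)
Definition affine_on (A : set R) (f : R -> R) := forall x y z u,
  A x -> A y -> A z -> A u -> (f x - f y) * (z - u) = (x - y) * (f z - f u).

Lemma gap_set_nil t x : gap_set t [::] x -> len t.+1 <= x <= shift t.
Proof. by rewrite /gap_set/= addn0 !add0r => /andP[? ?]; rewrite !ltW. Qed.

Lemma ramp_affine t : affine_on (gap_set t [::]) (ramp t).
Proof.
have rE x : gap_set t [::] x -> ramp t x = (x - len t.+1) / gap t.
  by rewrite /gap_set/= addn0 !add0r => /andP[? ?]; rewrite ramp_mid// !ltW.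
by move=> x y z u Gx Gy Gz Gu; rewrite !rE//; ring.
Qed.

Lemma digit_affine j t w : affine_on (gap_set t w) (digit j t).
Proof.
elim: w j t => [|b w IH] j t.
  case: j => [|j]; first exact: ramp_affine.
  have dE x : gap_set t [::] x -> digit j.+1 t x = 1 - ramp t x.
    by move=> /gap_set_nil Gx; rewrite digit_mid.
  move=> x y z u Gx Gy Gz Gu; rewrite !dE//.
  by have := ramp_affine Gx Gy Gz Gu; lra.
have Gb x : gap_set t (b :: w) x -> if b then shift t <= x else x <= len t.+1.
  by rewrite gap_set_cons => /gap_set_bound; case: b => /=; lra.
case: j => [|j] x y z u Gx Gy Gz Gu.
  move: (Gb x Gx) (Gb y Gy) (Gb z Gz) (Gb u Gu) => {Gx Gy Gz Gu} /=.
  by case: b {Gb} => *; [rewrite !ramp_right//|rewrite !ramp_left//]; ring.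
have dE v : gap_set t (b :: w) v -> digit j.+1 t v = digit j t.+1 (v - shift t * b%:R).
  move=> /Gb; case: b {Gb Gx Gy Gz Gu} => h; first by rewrite digit_right ?mulr1.
  by rewrite digit_left ?mulr0 ?subr0.
rewrite !dE//; rewrite !gap_set_cons in Gx Gy Gz Gu.
have := IH j t.+1 _ _ _ _ Gx Gy Gz Gu.
have -> (p q r : R) : p - r - (q - r) = p - q by lra.
by have -> (p q r : R) : p - r - (q - r) = p - q by lra.
Qed.

(** * The digit substitution map *)

Definition sparse_index i := ((i.+2) ^ 2)%N.

(** On the Cantor set this map turns the digits [omega] into
    [omega \o sparse_index]. Far away digits of a point thus become the leading
    digits of its image, which makes the map far from Lipschitz there, and
    sparseness makes the leading digits of successive iterates almost
    independent. *)
Definition cantor_map x := digit_sum 0 (fun i => digit (sparse_index i) 0 x).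

Let in01_digit x : in01 (fun i => digit (sparse_index i) 0 x).
Proof. by move=> i; exact: digit_01. Qed.

Lemma cantor_map_01 x : 0 <= cantor_map x <= 1.
Proof.
by apply/andP; split; [exact: digit_sum_ge0|rewrite -[leRHS]len0; exact: digit_sum_le].
Qed.

Lemma cantor_map0 : cantor_map 0 = 0.
Proof.
rewrite /cantor_map (_ : (fun _ => _) = fun=> 0) ?digit_sum0//.
by apply/funext => i; rewrite digit_le0.
Qed.

Lemma cantor_map1 : cantor_map 1 = 1.
Proof.
rewrite /cantor_map (_ : (fun _ => _) = fun=> 1) ?digit_sum1//.
by apply/funext => i; rewrite digit_ge_len// len0.
Qed.

Lemma cantor_map_pt omega : cantor_map (cantor_pt 0 omega) = cantor_pt 0 (omega \o sparse_index).
Proof.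
by rewrite /cantor_map /cantor_pt; congr digit_sum; apply/funext => i; rewrite digit_cantor_pt.
Qed.

Lemma cantor_map_affine w : affine_on (gap_set 0 w) cantor_map.
Proof.
move=> x y z u Gx Gy Gz Gu; apply: digit_sum_linear; [exact: in01_digit..|move=> i].
exact: (digit_affine _ Gx Gy Gz Gu).
Qed.

(** The tails of the digit sums are bounded uniformly by [len k], so the map is a
    uniform limit of continuous functions. *)
Lemma cantor_map_continuous : continuous cantor_map.
Proof.
move=> x; apply/cvgrPdist_le => e e0.
have [|k ke] := @len_small (e / 3); first exact: divr_gt0.
pose S x := \sum_(i < k) shift i * digit (sparse_index i) 0 x.
have Sc : continuous S.
  apply: continuous_big => [|i _ y]; first exact: add_continuous.
  by apply: cvgM; [exact: cvg_cst|exact: digit_continuous].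
have MS y : `|cantor_map y - S y| <= e / 3.
  exact: le_trans (digit_sum_approx k (in01_digit y)) ke.
have /cvgrPdist_le /(_ (e / 3)) := Sc x.
rewrite divr_gt0// => /(_ isT); apply: filterS => y Sxy.
have := MS x; have := MS y; move: Sxy; rewrite !ler_norml.
by move=> /andP[? ?] /andP[? ?] /andP[? ?]; apply/andP; split; lra.
Qed.

End cantor_model.

(** * Rates of separation and covering *)

(** The indices outside the range of [sparse_index]; a value exceeds its index,
    so the search may stop at [r]. *)
Definition is_root r := ~~ has (fun i => sparse_index i == r) (iota 0 r).

Lemma sparse_index_inj : injective sparse_index.
Proof. by move=> i j /eqP; rewrite eqn_exp2r// => /eqP[]. Qed.

Lemma not_root_sparse_index i : ~~ is_root (sparse_index i).
Proof.
rewrite negbK; apply/hasP; exists i => //; rewrite mem_iota/= add0n /sparse_index; nia.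
Qed.

(** Only about the square root of [k] of the first [k] indices are not roots. *)
Lemma count_root_ge k b : (k < b.+1 ^ 2)%N ->
  (k <= count is_root (iota 0 k) + b)%N.
Proof.
move=> kb; rewrite -[leqLHS](size_iota 0) -(count_predC is_root) leq_add2l.
rewrite -size_filter -(size_iota 0 b) -(size_map sparse_index); apply: uniq_leq_size.
  by rewrite filter_uniq// iota_uniq.
move=> r; rewrite mem_filter/= negbK mem_iota/= add0n => /andP[/hasP[i _ /eqP <-] ik].
apply: map_f; rewrite mem_iota/= add0n.
have : (sparse_index i < b.+1 ^ 2)%N by apply: ltn_trans kb.
by rewrite ltn_exp2r//; lia.
Qed.

Lemma sqrt_bracket k : exists b, (b ^ 2 <= k < b.+1 ^ 2)%N.
Proof.
elim: k => [|k [b /andP[b1 b2]]]; first by exists 0%N.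
have [h|h] := leqP (b.+1 ^ 2)%N k.+1; [exists b.+1|exists b]; apply/andP; split=> //.
- by rewrite (leq_ltn_trans b2)// ltn_exp2r.
- exact: leqW.
Qed.

(** Here [b] is the integer square root of [k]. The left-hand side collects all
    the losses: the ratio of [sep] to a pure power, the scale [N], and the
    indices that are not roots. It is subexponential in [k]. *)
Lemma polynomial_le_exp8 N b k : (0 < b)%N -> (2 * N <= b)%N -> (k < b.+1 ^ 2)%N ->
  (2 * N * (k.+2 * k.+3) * 2 ^ b <= 2 ^ (8 * b))%N.
Proof.
move=> b0 Nb kb.
have b2 : (b < 2 ^ b)%N by rewrite ltn_expl.
have k8 : (k.+3 <= 8 ^ b)%N.
  have b4 : (b.+1 ^ 2 <= 4 ^ b)%N.
    by rewrite (_ : 4 = 2 ^ 2)%N// -expnM mulnC expnM leq_exp2r.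
  apply: (@leq_trans (4 ^ b + 2)); first lia.
  rewrite (_ : 8 = 4 * 2)%N// expnMn.
  have : (2 <= 2 ^ b)%N by rewrite -{1}(expn1 2) leq_exp2l.
  have : (4 <= 4 ^ b)%N by rewrite -{1}(expn1 4) leq_exp2l.
  by move: (4 ^ b)%N (2 ^ b)%N => x y; nia.
have -> : (2 ^ (8 * b) = 2 ^ b * (8 ^ b * 8 ^ b) * 2 ^ b)%N.
  by rewrite (_ : 8 = 2 ^ 3)%N// -!expnM -!expnD; congr (_ ^ _)%N; lia.
rewrite leq_mul// leq_mul//; first exact: ltnW (leq_ltn_trans Nb b2).
by rewrite leq_mul// ltnW.
Qed.

Section rates.
Context {R : realType}.

(** Chosen so that [2 ^ k] pieces of length [scale_ratio a ^+ k] have dimension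
    [a]. *)
Definition scale_ratio (a : R) : R := 2 `^ (- a^-1).

Lemma scale_ratio_gt0 a : 0 < scale_ratio a.
Proof. by rewrite powR_gt0. Qed.

Lemma scale_ratio_le_half a : 0 < a <= 1 -> 2 * scale_ratio a <= 1.
Proof.
move=> /andP[a0 a1]; rewrite -[X in X * _]powRr1// -powRD ?pnatr_eq0 ?implybT//.
rewrite -[leRHS](powRr0 2) ler_powR// ?ler1n// subr_le0.
by rewrite -(invr1 R) lef_pV2 ?posrE.
Qed.

Lemma scale_ratioX_powR a k (s : R) : (scale_ratio a ^+ k) `^ s = 2 `^ (- (s / a) * k%:R).
Proof.
rewrite -powR_mulrn ?powR_ge0// /scale_ratio -!powRrM; congr (_ `^ _); ring.
Qed.

Lemma box_scale (a r : R) : 0 < a <= 1 -> 0 < r <= 1 ->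
  exists k, len (scale_ratio a) k <= r /\ (2 ^ k)%:R <= 2 * r `^ (- a).
Proof.
move=> /[dup] a01 /andP[a0 a1] /andP[r0 r1].
have [k kr kmin] := ex_minnP (len_small (scale_ratio_gt0 a) (scale_ratio_le_half a01) r0).
exists k; split => //; case: k kr kmin => [|k] kr kmin.
  have : 1 <= r `^ (- a).
    by rewrite -[leLHS](powRr0 r) ger_powR ?r0// oppr_le0 ltW.
  by rewrite expn0; lra.
have rk : r <= scale_ratio a ^+ k.
  apply: le_trans (len_le_lamX (scale_ratio_gt0 a) k); rewrite leNgt; apply/negP => kr'.
  by have := kmin k (ltW kr'); rewrite ltnn.
have -> : (2 ^ k.+1)%:R = 2 * (2 ^ k)%:R :> R by rewrite expnS natrM.
rewrite ler_wpM2l// powRN natrX.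
have -> : 2 ^+ k = ((scale_ratio a ^+ k) `^ a)^-1 :> R.
  by rewrite scale_ratioX_powR divff ?gt_eqF// mulN1r powR_invn// invrK.
rewrite lef_pV2 ?posrE ?powR_gt0 ?exprn_gt0 ?powR_gt0//.
by rewrite ge0_ler_powR// ?nnegrE ?exprn_ge0 ?powR_ge0// ltW.
Qed.

Lemma bernoulli_ineq (d : R) n : 0 <= d -> 1 + d *+ n <= (1 + d) ^+ n.
Proof.
move=> d0; elim: n => [|n IH]; first by rewrite mulr0n addr0 expr0.
rewrite exprS; have d1 : 0 <= 1 + d by lra.
apply: le_trans (ler_wpM2l d1 IH).
have : 0 <= d * (d *+ n) by rewrite mulr_ge0// mulrn_wge0.
by rewrite mulrS; lra.
Qed.

(** In units of powers of 2 the two sides decay like [k] and [(s / a) * k]; since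
    [s < a], the surplus exponential factor [beta ^+ k] beats the subexponential
    losses. *)
Lemma rate_eventually (a s : R) N : 0 < a <= 1 -> 0 < s < a -> (0 < N)%N ->
  exists k0, forall k, (k0 <= k)%N ->
    2^-1 ^+ count is_root (iota 0 k) <= (N%:R^-1 * sep (scale_ratio a) k.+1) `^ s.
Proof.
move=> /andP[a0 a1] /andP[s0 sa] N0.
(* the k-th power of (scale_ratio a) `^ s exceeds 2 ^- k by the factor beta ^+ k *)
pose beta : R := 2 `^ (1 - s / a).
have sa1 : 0 < 1 - s / a by rewrite subr_gt0 ltr_pdivrMr// mul1r.
have beta1 : 1 < beta.
  have := gt0_ltr_powR sa1 (_ : (1 : R) \in Num.nneg) (_ : (2 : R) \in Num.nneg).
  by rewrite powR1; apply; rewrite ?nnegrE// ltr1n.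
have [c cE] : exists c : R, c = 2 ^+ 8 by exists (2 ^+ 8).
have c0 : 0 <= c by rewrite cE exprn_ge0.
have [b0 b0P] : exists b0, c <= beta ^+ b0.
  have d0 : 0 < beta - 1 by rewrite subr_gt0.
  exists (Num.bound (c / (beta - 1))).
  have : c / (beta - 1) < (Num.bound (c / (beta - 1)))%:R.
    by apply: archi_boundP; rewrite divr_ge0// ltW.
  move: (Num.bound _) => n; rewrite ltr_pdivrMr// => nd.
  apply: (@le_trans _ _ (1 + (beta - 1) *+ n)).
    by rewrite -mulr_natl; lra.
  by have := bernoulli_ineq n (ltW d0); rewrite (addrC 1 (beta - 1)) subrK.
pose b1 := maxn b0 (maxn (2 * N) 1).
exists (b1 ^ 2)%N => k b1k.
have [b /andP[bk kb]] := sqrt_bracket k.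
have b1b : (b1 <= b)%N.
  have := leq_ltn_trans b1k kb; rewrite ltn_exp2r//.
have sepE : sep (scale_ratio a) k.+1 = scale_ratio a ^+ k.+1 / (k.+2%:R * k.+3%:R) by [].
rewrite sepE mulrCA powRM ?exprn_ge0 ?powR_ge0 ?mulr_ge0 ?invr_ge0//.
rewrite scale_ratioX_powR.
set d : R := N%:R^-1 / _.
have dE : d = ((N * (k.+2 * k.+3))%:R)^-1 by rewrite /d !natrM -!invfM.
have d01 : 0 < d <= 1.
  rewrite dE invr_gt0 ltr0n muln_gt0 N0/= invf_le1 ?ler1n ?ltr0n ?muln_gt0 ?N0//.
have dd : d <= d `^ s by apply: ger1_powR => //; lra.
apply: (le_trans _ (ler_wpM2l (powR_ge0 _ _) dd)).
have cnt : 2^-1 ^+ count is_root (iota 0 k) <= 2 ^+ b / 2 ^+ k :> R.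
  have := count_root_ge kb; move: (count _ _) => e ke.
  rewrite exprVn ler_pdivlMr ?exprn_gt0// mulrC ler_pdivrMr ?exprn_gt0//.
  by rewrite -exprD addnC ler_weXn2l// ler1n.
apply: (le_trans cnt).
have -> : 2 `^ (- (s / a) * k.+1%:R) = beta ^+ k.+1 / 2 ^+ k.+1.
  rewrite -powR_mulrn ?powR_ge0// -powRrM -(powR_mulrn k.+1)// -powRN.
  by rewrite -powRD ?pnatr_eq0 ?implybT//; congr (_ `^ _); ring.
have big : (2 * N * (k.+2 * k.+3) * 2 ^ b)%:R <= beta ^+ k.+1.
  have leb : (2 ^ (8 * b))%:R <= beta ^+ (b * b).
    rewrite natrX exprM -cE exprM lerXn2r// ?nnegrE ?exprn_ge0 ?(ltW (lt_trans _ beta1))//.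
    rewrite (le_trans b0P)// ler_weXn2l ?(ltW beta1)//.
    by rewrite (leq_trans _ b1b)// leq_maxl.
  rewrite (le_trans _ (le_trans leb _))//.
    by rewrite ler_nat polynomial_le_exp8// (leq_trans _ b1b)// !leq_max leqnn ?orbT.
  by rewrite ler_weXn2l ?(ltW beta1)// mulnn leqW.
rewrite dE ler_pdivlMr ?ltr0n ?muln_gt0 ?N0// ler_pdivlMr ?exprn_gt0//.
apply: le_trans big; rewrite !natrM !natrX exprS.
have : (2 : R) ^+ k != 0 by rewrite expf_neq0.
by move: (2 ^+ k) (2 ^+ b) => x y x0; rewrite le_eqVlt; apply/orP; left; apply/eqP; field.
Qed.

End rates.

(** * Functions on the unit interval *)

Section unit_interval_functions.
Context {R : realType}.
Notation UI := (unit_interval R).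

Fact clamp_mem (x : R) : clamp x \in (`[0, 1]%classic : set R).
Proof. by rewrite inE /= in_itv/= clamp_01. Qed.

Definition to_ui (x : R) : UI := exist _ (clamp x) (clamp_mem x).

Lemma ui_val_to_ui x : ui_val (to_ui x) = clamp x.
Proof. by []. Qed.

Lemma to_uiK x : 0 <= x <= 1 -> ui_val (to_ui x) = x.
Proof. by move=> x01; rewrite ui_val_to_ui clamp_id. Qed.

Lemma ui_valK (x : UI) : to_ui (ui_val x) = x.
Proof. by apply: val_inj; exact: (to_uiK (ui_val_itv x)). Qed.

Lemma ui_val_continuous : continuous (@ui_val R).
Proof.
move=> x A /nbhs_ballP[e /= e0 eA].
by apply/nbhs_ballP; exists e => //= y xy; exact: eA.
Qed.

Lemma to_ui_continuous : continuous to_ui.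
Proof.
move=> x A /nbhs_ballP[e /= e0 eA].
have /cvgrPdist_lt/(_ e e0) := @clamp_continuous R x.
by apply: filterS => y xy; exact: eA.
Qed.

Lemma heine_segment (h : R -> R) (e : R) : continuous h -> 0 < e ->
  exists2 d, 0 < d & forall x y, 0 <= x <= 1 -> 0 <= y <= 1 -> `|x - y| <= d ->
    `|h x - h y| <= e.
Proof.
move=> hc e0.
have /compact_near_coveringP cov := @segment_compact R 0 1.
have := cov _ 0^'+ (fun d x => forall y, `|x - y| <= d -> `|h x - h y| <= e) _ _.
case.
  move=> x _; have /cvgrPdist_lt/(_ (e / 2)) := hc x.
  rewrite divr_gt0// => /(_ isT)/nbhs_ballP[r /= r0 hr].
  exists (ball x (r / 2), [set d | d < r / 2]) => /=.
    split; first by apply: nbhsx_ballx; rewrite divr_gt0.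
    by apply: nbhs_right_lt; rewrite divr_gt0.
  move=> [z d] [/= xz dr] y zy.
  have r2 : 0 < r / 2 by rewrite divr_gt0.
  have hxz : `|h x - h z| < e / 2.
    by apply: hr; rewrite /ball/= in xz *; lra.
  have hxy : `|h x - h y| < e / 2.
    apply: hr; rewrite /ball/= in xz *.
    by have := ler_distD z x y; lra.
  by have := ler_distD (h x) (h z) (h y); rewrite (distrC (h z) (h x)); lra.
move=> d0 /= d00 H; exists (d0 / 2); first exact: divr_gt0.
move=> x y x01 _ xy; apply: (H (d0 / 2)) xy => //.
- by rewrite /ball/= sub0r normrN gtr0_norm; lra.
- by rewrite divr_gt0.
Qed.

End unit_interval_functions.

(** * Piecewise linear maps with one spliced cell *)

Section splice_map.
Context {R : realType}.
Notation UI := (unit_interval R).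
Variables (n p : nat) (v : nat -> R) (kap : R -> R).
Hypothesis n_gt0 : (0 < n)%N.
Hypothesis v01 : forall i, 0 <= v i <= 1.
Hypothesis kap0 : kap 0 = 0.
Hypothesis kap1 : kap 1 = 1.
Hypothesis kap01 : forall x, 0 <= kap x <= 1.
Hypothesis kap_continuous : continuous kap.

Let nR_gt0 : 0 < n%:R :> R. Proof. by rewrite ltr0n. Qed.

Definition cell_map i : R -> R := if i == p then kap else id.

(** The continuous function with values [v i] at the points [i / n], linear
    between them except on the cell [p], where the linear graph is replaced by a
    scaled graph of [kap]. As a sum of clamped functions it is continuous without
    a gluing argument; the truncation at [m] serves an induction. *)
Definition partial_splice m (x : R) : R := v 0%N +
  \sum_(i < m) (v i.+1 - v i) * cell_map i (clamp (n%:R * x - i%:R)).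

Definition in_cell i (x : R) := i%:R <= n%:R * x <= i.+1%:R.

Let cell_map0 i : cell_map i 0 = 0. Proof. by rewrite /cell_map; case: eqP. Qed.
Let cell_map1 i : cell_map i 1 = 1. Proof. by rewrite /cell_map; case: eqP. Qed.

Lemma partial_splice_cell m i x : in_cell i x -> partial_splice m x =
  if (m <= i)%N then v m else v i + (v i.+1 - v i) * cell_map i (n%:R * x - i%:R).
Proof.
move=> /andP[ix xi]; elim: m => [|m IH]; first by rewrite /partial_splice big_ord0 addr0.
rewrite /partial_splice big_ord_recr/= addrA -/(partial_splice m x) {}IH; case: ltngtP => mi.
- have mx : m%:R + 1 <= n%:R * x by rewrite natr1 (le_trans _ ix)// ler_nat.
  by rewrite clamp_ge1 ?cell_map1 ?mulr1 1?addrC ?subrK//; lra.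
- have xm : n%:R * x <= m%:R by rewrite (le_trans xi)// ler_nat.
  by rewrite (@clamp_le0 _ (_ - m%:R)) ?cell_map0 ?mulr0 ?addr0//; lra.
- have xi1 : n%:R * x <= i%:R + 1 by rewrite natr1.
  by rewrite mi clamp_id//; apply/andP; split; lra.
Qed.

Lemma cell_map_01 i x : 0 <= x <= 1 -> 0 <= cell_map i x <= 1.
Proof. by rewrite /cell_map; case: eqP => // _ _; exact: kap01. Qed.

Lemma in_cell_ex x : 0 <= x <= 1 -> exists2 i, (i < n)%N & in_cell i x.
Proof.
move=> /andP[x0 x1].
have nxn : n%:R * x <= n%:R by rewrite ler_piMr.
have [|i xi imin] := @ex_minnP (fun i => n%:R * x <= i.+1%:R).
  by exists n; rewrite (le_trans nxn)// ler_nat.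
have nx0 : 0 <= n%:R * x by rewrite mulr_ge0.
exists i.
  by rewrite -[X in (_ < X)%N](prednK n_gt0) ltnS; apply: imin; rewrite prednK.
rewrite /in_cell xi andbT; case: i xi imin => // i xi imin.
by rewrite leNgt; apply/negP => /ltW /imin; rewrite ltnn.
Qed.

Definition splice := partial_splice n.

Lemma splice_cell i x : (i < n)%N -> in_cell i x ->
  splice x = v i + (v i.+1 - v i) * cell_map i (n%:R * x - i%:R).
Proof. by move=> iN xi; rewrite /splice (partial_splice_cell _ xi) leqNgt iN. Qed.

Lemma splice_01 x : 0 <= x <= 1 -> 0 <= splice x <= 1.
Proof.
move=> /in_cell_ex[i iN xi]; rewrite (splice_cell iN xi).
have c01 : 0 <= n%:R * x - i%:R <= 1.
  by move: xi => /andP[]; rewrite -natr1 => ? ?; apply/andP; split; lra.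
have /andP[] := cell_map_01 i c01; move: (cell_map _ _) => c c0 c1.
have /andP[a0 a1] := v01 i; have /andP[b0 b1] := v01 i.+1.
apply/andP; split; nra.
Qed.

Lemma splice_continuous : continuous splice.
Proof.
suff Sc : continuous (fun x : R =>
    \sum_(i < n) (v i.+1 - v i) * cell_map i (clamp (n%:R * x - i%:R))).
  by move=> x; apply: cvgD; [exact: cvg_cst|exact: Sc].
apply: continuous_big => [|i _ x]; first exact: add_continuous.
apply: cvgM; first exact: cvg_cst.
have cc : continuous (cell_map i) by rewrite /cell_map; case: eqP => // _ y; exact: cvg_id.
apply: (@continuous_comp _ _ _ (fun x : R => clamp (n%:R * x - i%:R)) (cell_map i));
  last exact: cc.
apply: (@continuous_comp _ _ _ (fun x : R => n%:R * x - i%:R) clamp);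
  last exact: clamp_continuous.
apply: cvgB; last exact: cvg_cst.
by apply: cvgM; [exact: cvg_cst|exact: cvg_id].
Qed.

Definition splice_ui (x : UI) : UI := to_ui (splice (ui_val x)).

Lemma ui_val_splice_ui x : ui_val (splice_ui x) = splice (ui_val x).
Proof. by rewrite to_uiK// splice_01// ui_val_itv. Qed.

Lemma splice_ui_continuous : continuous splice_ui.
Proof.
move=> x; apply: (@continuous_comp _ _ _ (splice \o ui_val) to_ui); last exact: to_ui_continuous.
by apply: (@continuous_comp _ _ _ ui_val splice); [exact: ui_val_continuous|exact: splice_continuous].
Qed.


Definition real_box_dim_le (C : set R) (t : R) :=
  exists2 K : R, 0 <= K & forall r, 0 < r <= 1 ->
    exists M (P : nat -> set R), [/\ M%:R <= K * r `^ (- t),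
      C `<=` \bigcup_(l < M) P l &
      forall l x y, P l x -> P l y -> `|x - y| <= r].

(** A nonconstant affine map multiplies all distances by one positive constant. *)
Lemma affine_constant_or_expanding (B : set UI) :
  (forall x y z w, B x -> B y -> B z -> B w ->
    (splice (ui_val x) - splice (ui_val y)) * (ui_val z - ui_val w) =
    (ui_val x - ui_val y) * (splice (ui_val z) - splice (ui_val w))) ->
  constant_or_expanding splice_ui B.
Proof.
move=> aff; have [cst|] := pselect (forall x y, B x -> B y -> splice_ui x = splice_ui y).
  by left.
move=> /existsNP[z /existsNP[w /not_implyP[Bz /not_implyP[Bw Fzw]]]]; right.
have Fne : splice (ui_val z) - splice (ui_val w) != 0.
  by apply/eqP => /subr0_eq E; apply: Fzw; rewrite /splice_ui E.
have zw : ui_val z - ui_val w != 0.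
  by apply/eqP => /subr0_eq E; apply: Fzw; rewrite /splice_ui E.
exists (`|splice (ui_val z) - splice (ui_val w)| / `|ui_val z - ui_val w|).
  by rewrite divr_gt0// normr_gt0.
move=> x y Bx By; rewrite le_eqVlt; apply/orP; left; apply/eqP.
rewrite -[mdist x y]/(`|ui_val x - ui_val y|).
rewrite -[mdist (splice_ui x) _]/(`|ui_val (splice_ui x) - ui_val (splice_ui y)|) !ui_val_splice_ui.
have := aff x y z w Bx By Bz Bw => /(congr1 (fun t => `|t|)).
rewrite !normrM => E; rewrite mulrAC; apply: (mulIf (_ : `|ui_val z - ui_val w| != 0)).
  by rewrite normr_eq0.
by rewrite mulfVK ?normr_eq0// E mulrC.
Qed.

Lemma in_cell_dist m i x y : (0 < m)%N ->
  i%:R <= m%:R * x <= i.+1%:R -> i%:R <= m%:R * y <= i.+1%:R ->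
  `|x - y| <= m%:R^-1 :> R.
Proof.
move=> m0; rewrite -natr1 => /andP[x1 x2] /andP[y1 y2].
have m0' : 0 < m%:R :> R by rewrite ltr0n.
rewrite -[leRHS]mul1r ler_pdivlMr// -[X in _ * X]gtr0_norm// -normrM mulrC.
by rewrite mulrBr ler_norml; apply/andP; split; lra.
Qed.

End splice_map.

Section unit_interval_box.
Context {R : realType}.
Notation UI := (unit_interval R).

Lemma box_dim_unit_interval : box_dim_le [set: UI] 1.
Proof.
exists 2 => // r /andP[r0 r1].
have rV0 : 0 < r^-1 by rewrite invr_gt0.
have [|M Mr Mmin] := @ex_minnP (fun M => r^-1 <= M%:R).
  by exists (Num.bound r^-1); rewrite ltW// archi_boundP// ltW.
have M0 : (0 < M)%N by rewrite -(ltr0n R) (lt_le_trans rV0).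
exists M, (fun l => [set x : UI | in_cell M l (ui_val x)]); split.
- rewrite powR_inv1 ?ltW//.
  have M1 : M.-1%:R < r^-1.
    by rewrite ltNge; apply/negP => /Mmin; rewrite leqNgt prednK ?leqnn.
  have : 1 <= r^-1 by rewrite invf_ge1.
  by rewrite -[in M%:R](prednK M0) -natr1; lra.
- by move=> x _; have [l lM lx] := in_cell_ex M0 (ui_val_itv x); exists l.
- move=> l x y lx ly; rewrite -[mdist x y]/(`|ui_val x - ui_val y|).
  rewrite (le_trans (in_cell_dist M0 lx ly))//.
  by rewrite -[leRHS]invrK lef_pV2 ?posrE ?ltr0n.
Qed.

End unit_interval_box.

Section splice_dimension.
Context {R : realType}.
Notation UI := (unit_interval R).
Variables (n p : nat) (v : nat -> R) (kap : R -> R).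
Hypothesis n_gt0 : (0 < n)%N.
Hypothesis pn : (p < n)%N.
Hypothesis v01 : forall i, 0 <= v i <= 1.
Hypothesis vp : v p = p%:R / n%:R.
Hypothesis vp1 : v p.+1 = p.+1%:R / n%:R.
Hypothesis kap0 : kap 0 = 0.
Hypothesis kap1 : kap 1 = 1.
Hypothesis kap01 : forall x, 0 <= kap x <= 1.

Let nR_gt0 : 0 < n%:R :> R. Proof. by rewrite ltr0n. Qed.
Let phi : UI -> UI := splice_ui n p v kap.

(** The countably many pieces off the scaled copy of [C] are the linear cells and
    the scaled pieces on which [kap] is affine. *)
Theorem splice_hausdorff_dim_le (C : set R) (A : nat -> set R) (a : R) m eps :
  0 <= a -> 0 < eps -> real_box_dim_le C a ->
  (forall x, 0 <= x <= 1 -> C x \/ exists j, A j x) ->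
  (forall j, A j `<=` [set x | 0 <= x <= 1]) ->
  (forall j, affine_on (A j) kap) ->
  (hausdorff_dim phi m.+1 eps <= (m%:R * a + 1)%:E)%E.
Proof.
move=> a0 e0 [K K0 boxC] cov A01 Aaff.
pose C' : set UI := [set x | in_cell n p (ui_val x) /\ C (n%:R * ui_val x - p%:R)].
pose B j : set UI := match unpickle j : option (nat + nat)%type with
  | Some (inl i) => if (i < n)%N && (i != p)
      then [set x | in_cell n i (ui_val x)] else set0
  | Some (inr j) => [set x | A j (n%:R * ui_val x - p%:R)]
  | None => set0 end.
apply: (@hausdorff_dim_le _ _ phi C' B) => //.
- exact: box_dim_unit_interval.
- exists K => // r r01; have [M [P [Mle CP Pr]]] := boxC r r01.
  exists M, (fun l => [set x | P l (n%:R * ui_val x - p%:R)]); split => //.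
    by move=> x [_ Cx]; have [l lM Pl] := CP _ Cx; exists l.
  move=> l x y Px Py; rewrite -[mdist x y]/(`|ui_val x - ui_val y|).
  have := Pr _ _ _ Px Py.
  have -> (s t u : R) : s - u - (t - u) = s - t by lra.
  rewrite -mulrBr normrM gtr0_norm//; apply: le_trans.
  by rewrite ler_peMl// ler1n.
- apply/seteqP; split => // x _.
  have [i iN ix] := in_cell_ex n_gt0 (ui_val_itv x).
  have [ip|ip] := eqVneq i p; last first.
    by right; exists (pickle (inl i : nat + nat)%type) => //; rewrite /B pickleK iN ip.
  rewrite ip in ix; have y01 : 0 <= n%:R * ui_val x - p%:R <= 1.
    by move: ix; rewrite /in_cell -natr1 => /andP[? ?]; apply/andP; split; lra.
  have [Cx|[j Aj]] := cov _ y01; first by left.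
  by right; exists (pickle (inr j : nat + nat)%type) => //; rewrite /B pickleK.
- move=> j; apply: affine_constant_or_expanding => //.
  rewrite /B; case: (unpickle j) => [[i|k]|] //.
    case: ifP => // /andP[iN ip] x y z w Bx By Bz Bw.
    rewrite !(splice_cell _ _ kap0 kap1 iN)// /cell_map (negbTE ip); ring.
  move=> x y z w Bx By Bz Bw.
  have cellp u : A k (n%:R * u - p%:R) -> in_cell n p u.
    by move=> /A01 /= /andP[? ?]; rewrite /in_cell -natr1; apply/andP; split; lra.
  rewrite !(splice_cell _ _ kap0 kap1 pn) ?cellp// /cell_map eqxx.
  have := Aaff k _ _ _ _ Bx By Bz Bw.
  have -> (s t u : R) : s - u - (t - u) = s - t by lra.
  have -> (s t u : R) : s - u - (t - u) = s - t by lra.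
  rewrite -!mulrBr => E.
  apply: (mulfI (_ : n%:R != 0 :> R)); first by rewrite gt_eqF.
  move: E; move: (kap _) (kap _) (kap _) (kap _) => k4 k3 k2 k1 E.
  transitivity ((v p.+1 - v p) * ((k1 - k2) * (n%:R * (ui_val z - ui_val w)))).
    by ring.
  by rewrite E; ring.
Qed.

(** The hypotheses on [v p] and [v p.+1] make the cell [p] invariant, and the map
    on it conjugate to [kap] by a similarity. *)
Theorem splice_hausdorff_dim_ge (a s : R) : 0 < a <= 1 -> 0 < s < a ->
  kap = cantor_map (scale_ratio a) ->
  exists2 e0 : R, 0 < e0 & forall m eps, (0 < m)%N -> 0 < eps < e0 ->
    ((m%:R * s)%:E <= hausdorff_dim phi m eps)%E.
Proof.
move=> a01 sa kE; have l0 := scale_ratio_gt0 a; have l1 := scale_ratio_le_half a01.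
have [k0 k0P] := rate_eventually a01 sa n_gt0.
pose rho k := n%:R^-1 * sep (scale_ratio a) k.
have nV0 : 0 < n%:R^-1 :> R by rewrite invr_gt0.
have rho0 k : 0 < rho k by rewrite mulr_gt0// sep_gt0.
pose Pi omega : UI := to_ui ((p%:R + cantor_pt (scale_ratio a) 0 omega) / n%:R).
have c01 omega : 0 <= cantor_pt (scale_ratio a) 0 omega <= 1.
  by rewrite cantor_pt_ge0//= -(len0 (scale_ratio a)) cantor_pt_le.
have PiE omega : ui_val (Pi omega) = (p%:R + cantor_pt (scale_ratio a) 0 omega) / n%:R.
  rewrite to_uiK//; have /andP[? ?] := c01 omega; apply/andP; split.
    by rewrite divr_ge0 ?addr_ge0.
  rewrite ler_pdivrMr// mul1r (le_trans (_ : _ <= p.+1%:R)) ?ler_nat//.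
  by rewrite -natr1 lerD2l.
have nPi omega : n%:R * ui_val (Pi omega) = p%:R + cantor_pt (scale_ratio a) 0 omega.
  by rewrite PiE mulrC divfK// gt_eqF.
exists (rho k0) => // m eps m0 ebd.
apply: (@hausdorff_dim_ge _ _ phi Pi sparse_index is_root rho s k0) => //.
- move=> omega; apply: val_inj; rewrite -[LHS]/(ui_val _) -[RHS]/(ui_val _).
  rewrite ui_val_splice_ui//.
  have cp : in_cell n p (ui_val (Pi omega)).
    have /andP[? ?] := c01 omega.
    by rewrite /in_cell nPi -natr1; apply/andP; split; lra.
  rewrite (splice_cell _ _ kap0 kap1 pn cp) /cell_map eqxx nPi (addrC p%:R) addrK PiE kE.
  rewrite cantor_map_pt// vp vp1 -natr1; field; rewrite gt_eqF//.
- exact: sparse_index_inj.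
- exact: not_root_sparse_index.
- by move=> i j ij; rewrite ler_wpM2l ?(ltW nV0)// sep_noninc.
- move=> e e0; have [k ke] := sep_small l0 l1 e0; exists k.
  rewrite (le_trans _ ke)// ler_piMl ?(ltW (sep_gt0 _ _))//.
  by rewrite invf_le1// ler1n.
- move=> k omega omega' dlt i ik; apply/eqP; apply/negPn/negP => ne.
  move: dlt; rewrite ltNge => /negP; apply.
  rewrite -[mdist _ _]/(`|ui_val (Pi omega) - ui_val (Pi omega')|) !PiE.
  rewrite -mulrBl normrM mulrC (gtr0_norm nV0) ler_wpM2l ?(ltW nV0)//.
  have -> (x y z : R) : x + y - (x + z) = y - z by lra.
  rewrite (le_trans _ (cantor_pt_sep l0 l1 0 ne))// sep_noninc// ltnW//.
- by case/andP: sa.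
Qed.

End splice_dimension.

Section model_pieces.
Context {R : realType}.
Variable a : R.
Hypothesis a01 : 0 < a <= 1.

Let l0 : 0 < scale_ratio a := scale_ratio_gt0 a.
Let l1 : 2 * scale_ratio a <= 1 := scale_ratio_le_half a01.

Definition cantor_set : set R :=
  [set x | 0 <= x <= 1 /\ forall w, ~ gap_set (scale_ratio a) 0 w x].

Definition gap_piece (j : nat) : set R :=
  if unpickle j is Some w then gap_set (scale_ratio a) 0 w else set0.

(** The pieces of level [k] are listed by the words of length [k]. *)
Lemma cantor_set_box_dim_le : real_box_dim_le cantor_set a.
Proof.
exists 2 => // r r01; have [k [kr kM]] := box_scale a01 r01.
pose word l : seq bool := nth [::] [seq val t | t : k.-tuple bool] l.
exists (2 ^ k)%N, (fun l => [set x | offset (scale_ratio a) 0 (word l) <= x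
   <= offset (scale_ratio a) 0 (word l) + len (scale_ratio a) k]); split => //.
- move=> x [x01 nG]; rewrite -(len0 (scale_ratio a)) in x01.
  have [w [sw wx]] := outside_gaps k x01 nG.
  have w_in : w \in [seq val t | t : k.-tuple bool].
    by apply/mapP; exists (tcast sw (in_tuple w));
      [rewrite mem_enum|rewrite -[RHS]/(tval _) val_tcast].
  exists (index w [seq val t | t : k.-tuple bool]) => /=.
    by rewrite -[X in (_ < X)%N](_ : size [seq val t | t : k.-tuple bool] = _)
      ?index_mem// size_map -cardE card_tuple card_bool.
  by rewrite /word nth_index.
- move=> l x y /andP[? ?] /andP[? ?]; rewrite (le_trans _ kr)// ler_norml.
  by apply/andP; split; lra.
Qed.

Lemma cantor_set_or_gap x : 0 <= x <= 1 -> cantor_set x \/ exists j, gap_piece j x.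
Proof.
move=> x01; have [[w Gw]|nG] := pselect (exists w, gap_set (scale_ratio a) 0 w x).
  by right; exists (pickle w); rewrite /gap_piece pickleK.
by left; split => // w Gw; apply: nG; exists w.
Qed.

Lemma gap_piece_01 j : gap_piece j `<=` [set x | 0 <= x <= 1].
Proof.
rewrite /gap_piece; case: (unpickle j) => // w x /(gap_set_bound l0 l1).
by rewrite len0.
Qed.

Lemma gap_piece_affine j : affine_on (gap_piece j) (cantor_map (scale_ratio a)).
Proof.
rewrite /gap_piece; case: (unpickle j) => // w; exact: cantor_map_affine l0 l1 w.
Qed.

End model_pieces.

(** * Density *)

Section density.
Context {R : realType}.
Notation UI := (unit_interval R).

(** On a grid of mesh [1 / n] the function [f - id] passes from nonnegative to
    nonpositive in some cell [p]; by uniform continuity both ends of that cell are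
    then almost fixed, and prescribing them as fixed points of the interpolating
    function changes it little. On the cell [p] any [kap] keeps the values
    between the two ends, which are close together. *)
Lemma splice_near (f : C0 R) (e : R) : 0 < e -> exists n p (v : nat -> R),
  [/\ [/\ (0 < n)%N, (p < n)%N, forall i, 0 <= v i <= 1,
         v p = p%:R / n%:R & v p.+1 = p.+1%:R / n%:R] &
     forall kap, kap 0 = 0 -> kap 1 = 1 -> (forall x, 0 <= kap x <= 1) ->
       forall x, 0 <= x <= 1 -> `|ui_val (f (to_ui x)) - splice n p v kap x| <= e].
Proof.
move=> e0; pose h x := ui_val (f (to_ui x)).
have hc : continuous h.
  move=> x; apply: (@continuous_comp _ _ _ (f \o to_ui) ui_val);
    last exact: ui_val_continuous.
  apply: (@continuous_comp _ _ _ to_ui f); first exact: to_ui_continuous.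
  exact: cts_fun.
have h01 x : 0 <= h x <= 1 by exact: ui_val_itv.
(* the errors below add up to 8 * e1: 5 from the variation of v on a cell, 2 from
   moving the ends of the cell p, 1 from the oscillation of f *)
pose e1 := e / 8; have e10 : 0 < e1 by rewrite divr_gt0.
have [d d0 hd] := heine_segment hc e10.
have [n n0 nle] : exists2 n, (0 < n)%N & n%:R^-1 <= Num.min d e1.
  exists (Num.bound (Num.min d e1)^-1).+1 => //.
  have m0 : 0 < Num.min d e1 by rewrite lt_min d0.
  have mV0 : 0 < (Num.min d e1)^-1 by rewrite invr_gt0.
  have mb := archi_boundP (ltW mV0).
  rewrite -[leRHS]invrK lef_pV2 ?posrE ?ltr0n//.
  by rewrite (le_trans (ltW mb))// ler_nat.
have nR0 : 0 < n%:R :> R by rewrite ltr0n.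
have [nd ne1] : n%:R^-1 <= d /\ n%:R^-1 <= e1.
  by move: nle; rewrite le_min => /andP[].
have grid01 i : (i <= n)%N -> 0 <= (i%:R / n%:R : R) <= 1.
  by move=> iN; rewrite divr_ge0//= ler_pdivrMr// mul1r ler_nat.
have gridS i : i.+1%:R / n%:R = i%:R / n%:R + n%:R^-1 :> R.
  by rewrite -natr1 mulrDl mul1r.
have [|p gp pmin] := @ex_minnP (fun i => h (i.+1%:R / n%:R) <= i.+1%:R / n%:R).
  by exists n.-1; rewrite prednK// divff ?gt_eqF//; have /andP[] := h01 1.
have pn : (p < n)%N.
  rewrite -[X in (_ < X)%N](prednK n0) ltnS; apply: pmin.
  by rewrite prednK// divff ?gt_eqF//; have /andP[] := h01 1.
have gp0 : p%:R / n%:R <= h (p%:R / n%:R).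
  case: p gp pmin pn => [|p] gp pmin pn; first by rewrite mul0r; have /andP[] := h01 0.
  by rewrite leNgt; apply/negP => /ltW /pmin; rewrite ltnn.
have hS i : (i < n)%N -> `|h (i%:R / n%:R) - h (i.+1%:R / n%:R)| <= e1.
  move=> iN; apply: hd; [exact/grid01/ltnW|exact: grid01|].
  by rewrite gridS opprD addrA subrr sub0r normrN gtr0_norm// invr_gt0.
(* only the two ends of the cell p are moved *)
pose v i := if (i == p) || (i == p.+1) then i%:R / n%:R else h (i%:R / n%:R).
have vh i : `|v i - h (i%:R / n%:R)| <= 2 * e1.
  rewrite /v; case: ifP => [|_]; last by rewrite subrr normr0 mulr_ge0// ltW.
  have := hS p pn; rewrite !ler_norml => /andP[h1 h2].
  have := gridS p => gS.
  by move=> /orP[]/eqP->; apply/andP; split; lra.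
exists n, p, v; split.
  split=> //.
  - move=> i; rewrite /v; case: ifP => // /orP[]/eqP->; apply: grid01 => //.
    exact: ltnW.
  - by rewrite /v eqxx.
  - by rewrite /v eqxx orbT.
move=> kap kap0 kap1 kap01 x x01.
have [i iN ix] := in_cell_ex n0 x01.
rewrite (splice_cell _ _ kap0 kap1 iN ix) -/(h x).
have c01 : 0 <= n%:R * x - i%:R <= 1.
  by move: ix; rewrite /in_cell -natr1 => /andP[? ?]; apply/andP; split; lra.
have /andP[] := cell_map_01 p kap01 i c01; move: (cell_map _ _ _ _) => c c0 c1.
have hx : `|h x - h (i%:R / n%:R)| <= e1.
  apply: hd => //; first exact/grid01/ltnW.
  rewrite (le_trans _ nd)//; apply: (in_cell_dist (i := i)) => //.
  by rewrite mulrC divfK ?gt_eqF// lexx ler_nat /=.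
have := vh i; have := vh i.+1; have := hS i iN.
move: hx; rewrite !ler_norml.
move: (h x) (h _) (h _) (v i) (v i.+1) => hx hi hi1 vi vi1.
move=> /andP[A1 A2] /andP[B1 B2] /andP[C1 C2] /andP[D1 D2].
have e8 : e = 8 * e1 by rewrite /e1 mulrC divfK.
apply/andP; split; rewrite e8; nra.
Qed.

End density.

(** For [a = 0] the inserted function is [clamp], linear on the cell, with an
    empty Cantor set; otherwise it is [cantor_map]. *)
Lemma splice_mdimH (R : realType) (a : R) : 0 <= a <= 1 ->
  exists kap : R -> R, [/\ continuous kap, kap 0 = 0, kap 1 = 1,
    forall x, 0 <= kap x <= 1 &
    forall n p (v : nat -> R), (0 < n)%N -> (p < n)%N ->
      (forall i, 0 <= v i <= 1) ->
      v p = p%:R / n%:R -> v p.+1 = p.+1%:R / n%:R ->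
      upper_mdimH (splice_ui n p v kap) = a%:E /\
      lower_mdimH (splice_ui n p v kap) = a%:E].
Proof.
move=> /andP[]; rewrite le_eqVlt => /orP[/eqP <- _|a0 a1].
  exists clamp; split.
  - exact: clamp_continuous.
  - by rewrite clamp_le0.
  - by rewrite clamp_ge1.
  - exact: clamp_01.
  - move=> n p v n0 pn v01 vp vp1.
    apply: mdimH_eq => [|//|m eps eps0|s]; first exact: to_ui 0.
      apply: (@splice_hausdorff_dim_le R n p v clamp _ _ _ _ _ _ set0
        (fun=> [set x | 0 <= x <= 1])) => //.
      - by rewrite clamp_le0.
      - by rewrite clamp_ge1.
      - exact: clamp_01.
      - exists 0 => // r _; exists 0%N, (fun=> set0); split=> //.
        by rewrite mul0r.
      - by move=> x x01; right; exists 0%N.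
      - by move=> _ x.

      - move=> _ x y z w x01 y01 z01 w01.
        by rewrite (clamp_id x01) (clamp_id y01) (clamp_id z01) (clamp_id w01).
    by move=> /andP[s0 /(lt_trans s0)]; rewrite ltxx.
have a01 : 0 < a <= 1 by rewrite a0.
have l0 := scale_ratio_gt0 a; have l1 := scale_ratio_le_half a01.
have m0 := cantor_map0 l0 l1; have m1 := cantor_map1 l0 l1.
have m01 := cantor_map_01 l0 l1.
exists (cantor_map (scale_ratio a)); split => //; first exact: cantor_map_continuous.
move=> n p v n0 pn v01 vp vp1.
apply: mdimH_eq => [||m eps eps0|s sa]; [exact: to_ui 0|exact: ltW| |].
  apply: (@splice_hausdorff_dim_le R n p v _ _ _ _ _ _ _
    (cantor_set a) (gap_piece a)) => //; first exact: ltW.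
  - exact: cantor_set_box_dim_le.
  - exact: cantor_set_or_gap.
  - exact: gap_piece_01.
  - exact: gap_piece_affine.
exact: splice_hausdorff_dim_ge sa _.
Qed.

Theorem theorem3p1 (R : realType) (a : R) (ha : 0 <= a <= 1) :
  dense (mdimH_level a).
Proof.
move=> O [f Of] Oopen.
have /nbhs_ballP[e /= e0 eO] : nbhs f O by apply: open_nbhs_nbhs.
have [kap [kc kap0 kap1 kap01 level]] := splice_mdimH ha.
have e20 : 0 < e / 2 by rewrite divr_gt0.
have [n [p [v [[n0 pn v01 vp vp1] near_f]]]] := splice_near f e20.
pose g : C0 R := mkcts (@splice_ui_continuous R n p v kap kc).
exists g; split; last exact: level.
apply: eO; rewrite ballEmdist /=.
apply: (@le_lt_trans _ _ (e / 2)); last by rewrite ltr_pdivrMr// ltr_pMr// ltr1n.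
apply: C0_dist_le => x; rewrite -[mdist _ _]/(`|ui_val (f x) - ui_val (splice_ui n p v kap x)|).
rewrite ui_val_splice_ui// -{1}(ui_valK x).
exact: near_f (ui_val_itv x).
Qed.
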